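(* Let $(\mathcal{X},d)$ be a Polish space, $\mu\in\mathcal{P}(\mathcal{X})$, and let $c$ be a power type cost function with exponent $p_o$ and $\tilde d=c^{1/p_o}$. Suppose there exist $a'>0$ and $r_o\ge0$ such that for every Borel $A\subset\mathcal{X}$ with $\mu(A)\ge1/2$, $\mu(A_r)\ge1-e^{-(r-r_o)^{p_o}/a'}$ for all $r\ge r_o$, where $A_r=\{x:\exists y\in A,\ \tilde d(x,y)\le r\}$. Then for all $a>a'$, the functional $F_a(\nu)=aH(\nu|\mu)-\mathcal{T}_c(\nu,\mu)$ admits at least one minimizer on $\mathcal{P}_\mu(\mathcal{X})$.
   Context: A power type cost function is $c(x,y)=\phi(d(x,y))$ with $\phi:\mathbb{R}^+\to\mathbb{R}^+$ convex, $\phi(0)=0$, $\phi(x)>0$ for $x>0$, $\sup_{x>0}\phi(2x)/\phi(x)<\infty$; its exponent is $p_o=\sup_{x>0}x\phi'(x)/\phi(x)$ ($\phi'$ the right derivative), and $\tilde d=c^{1/p_o}$ is a distance. $H(\nu|\mu)=\int\log(d\nu/d\mu)\,d\nu$ if $\nu\ll\mu$, $+\infty$ otherwise; $\mathcal{P}_\mu(\mathcal{X})=\{\nu:H(\nu|\mu)<\infty\}$; $\mathcal{T}_c(\nu_1,\nu_2)=\inf_\pi\iint c\,d\pi$ over couplings $\pi$ of $\nu_1,\nu_2$. *)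

(* Defs.v *)
From HB Require Import structures.
From mathcomp Require Import all_boot all_order all_algebra.
From mathcomp Require Import all_classical all_reals all_analysis.
Set Implicit Arguments. Unset Strict Implicit. Unset Printing Implicit Defensive.
Import Order.TTheory GRing.Theory Num.Theory numFieldNormedType.Exports.
Local Open Scope classical_set_scope.
Local Open Scope ring_scope.

Section polish.
Context {R : realType} {T : Type} (dist : T -> T -> R).

Definition is_metric : Prop :=
  [/\ forall x y, 0 <= dist x y,
      forall x y, dist x y = 0 <-> x = y,
      forall x y, dist x y = dist y x &
      forall x y z, dist x z <= dist x y + dist y z].

Definition dist_open : set (set T) :=
  [set U | forall x, U x -> exists2 r : R, 0 < r & [set y | dist x y < r] `<=` U].

Definition dist_complete : Prop :=
  forall u : nat -> T,
    (forall e : R, 0 < e -> exists N, forall m n, (N <= m)%N -> (N <= n)%N ->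
       dist (u m) (u n) < e) ->
    exists l, forall e : R, 0 < e -> exists N, forall n, (N <= n)%N -> dist (u n) l < e.

Definition dist_separable : Prop :=
  exists D : set T, countable D /\
    forall x (e : R), 0 < e -> exists2 y, D y & dist x y < e.

Definition polish : Prop := [/\ is_metric, dist_complete & dist_separable].

End polish.

Definition borel_for {d} {X : measurableType d} {R : realType} (dist : X -> X -> R) : Prop :=
  @measurable d X = <<s dist_open dist >>.

Section power_type.
Context {R : realType} (phi : R -> R).

Definition power_type : Prop :=
  [/\ (forall x, 0 <= x -> 0 <= phi x),
      (forall x y t, 0 <= x -> 0 <= y -> 0 <= t <= 1 ->
         phi (t * x + (1 - t) * y) <= t * phi x + (1 - t) * phi y),
      phi 0 = 0,
      (forall x, 0 < x -> 0 < phi x) &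
      (exists K : R, forall x, 0 < x -> phi (2 * x) / phi x <= K)].

Definition right_deriv (x : R) : R :=
  lim ((fun h : R => (phi (x + h) - phi x) / h) @ 0^'+).

Definition cost_exponent : R :=
  sup [set x * right_deriv x / phi x | x in [set x : R | 0 < x]].

End power_type.

(** tilde d = c^{1/p_o}, with c(x,y) = phi (d(x,y)) *)
Definition dtilde {R : realType} {T : Type} (dist : T -> T -> R) (phi : R -> R)
  (x y : T) : R := (phi (dist x y)) `^ (cost_exponent phi)^-1.

Definition enlargement {R : realType} {T : Type} (dt : T -> T -> R) (A : set T) (r : R)
  : set T := [set x | exists2 y, A y & dt x y <= r].

Section entropy_transport.
Context {d} {X : measurableType d} {R : realType}.

Definition relative_entropy (mu nu : probability X R) : \bar R :=
  match pselect (nu `<< mu) with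
  | left _ => (\int[nu]_x
      (ln (fine (Radon_Nikodym (charge_of_finite_measure nu) mu x)))%:E)%E
  | right _ => +oo%E
  end.

Definition coupling (nu1 nu2 : probability X R) (pi : probability (X * X)%type R) : Prop :=
  forall A, measurable A -> pi (A `*` setT) = nu1 A /\ pi (setT `*` A) = nu2 A.

Definition transport_cost (c : X -> X -> R) (nu1 nu2 : probability X R) : \bar R :=
  ereal_inf [set (\int[pi]_z (c z.1 z.2)%:E)%E | pi in coupling nu1 nu2].

Definition F_functional (c : X -> X -> R) (a : R) (mu nu : probability X R) : \bar R :=
  (a%:E * relative_entropy mu nu - transport_cost c nu mu)%E.

End entropy_transport.

(* Main.v *)
Require Import Defs.
From HB Require Import structures.
From mathcomp Require Import all_boot all_order all_algebra.
From mathcomp Require Import all_classical all_reals all_analysis.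
From mathcomp Require Import measurable_realfun ring lra.

(** For [H(nu|mu)] finite, Young's inequality [u v <= u ln u - u + e^v] bounds
    [int h dnu] by [H(nu|mu) - 1 + int e^h dmu]. Concentration makes
    [e^(psi/b)] integrable for some [b < a], where [psi x = (1 + eta) c(x, x0)] and
    [c(x, y) <= psi x + C psi y]; hence [T_c(nu, mu) <= b H(nu|mu) + const], [F_a] is
    bounded below, and a minimizing sequence [nu_n] has bounded entropy. It is
    therefore equi-absolutely continuous with respect to [mu], so its setwise limit
    along an ultrafilter is a probability [nu], which has finite entropy.

    [F_a] is lower semicontinuous along this limit. Partition [X] into finitely many
    cells of small diameter and a rest of small [mu]-measure. A nearly optimal
    coupling of [(nu, mu)] is turned into a coupling of [(nu_n, mu)] by resampling the
    first coordinate within its cell; only setwise convergence on the cells is needed,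
    and the loss is at most [int psi dnu_n] over the rest, plus a small error. This
    loss is absorbed by applying Young's inequality to a truncation of [ln (dnu/dmu)]
    plus [psi/a] on the rest. *)

Set Implicit Arguments. Unset Strict Implicit. Unset Printing Implicit Defensive.
Import Order.TTheory GRing.Theory Num.Theory numFieldNormedType.Exports.
Local Open Scope classical_set_scope.
Local Open Scope ring_scope.

(** Transport costs are typically lower semicontinuous, so the term [- transport_cost] goes the
    wrong way, and bounded entropy bounds the [psi]-moments without preventing [psi]-mass from
    escaping along the sequence. Entropy and transport are therefore treated together: mass escaping
    to the rest costs entropy, and at rate [a] that entropy pays for it. This exchange is exact only
    if the first variable enters the cost bound as [psi x] with coefficient 1, so [psi] may exceed
    the cost to [x0] only by a factor close to 1; the second variable is integrated against the
    fixed [mu], and there any constant [C] will do.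

    The gap between [a'] and [a] is split at [b]. The part from [a'] to [b] pays for the factors
    [1 + eta] and for the shift [r_o]; the part from [b] to [a] makes the functional coercive in the
    entropy.

    The ultrafilter gives a limit on all measurable sets at once, so cells that are merely
    measurable and bounded measurable functions can be used freely. *)

(** * Convexity and doubling estimates for power type functions *)

Section power_type_theory.
Context {R : realType} (phi : R -> R).
Hypothesis phiP : power_type phi.

Let phi_ge0 x : 0 <= x -> 0 <= phi x. Proof. by case: phiP => + _ _ _ _; exact. Qed.
Let phi0 : phi 0 = 0. Proof. by case: phiP. Qed.
Let phi_gt0 x : 0 < x -> 0 < phi x. Proof. by case: phiP => _ _ _ + _; exact. Qed.

Let phi_conv x y t : 0 <= x -> 0 <= y -> 0 <= t <= 1 ->
  phi (t * x + (1 - t) * y) <= t * phi x + (1 - t) * phi y.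
Proof. by case: phiP => _ + _ _ _; exact. Qed.

Lemma power_type_scale_le t x : 0 <= x -> 0 <= t <= 1 -> phi (t * x) <= t * phi x.
Proof.
by move=> x0 t01; have := phi_conv x0 (lexx 0) t01; rewrite phi0 !mulr0 !addr0.
Qed.

Lemma power_type_nondecreasing x y : 0 <= x -> x <= y -> phi x <= phi y.
Proof.
move=> x0 xy; have [->|xn0] := eqVneq x 0.
  by rewrite phi0 phi_ge0// (le_trans x0).
have y0 : 0 < y by rewrite (lt_le_trans _ xy)// lt0r xn0.
have t01 : 0 <= x / y <= 1.
  by rewrite divr_ge0 ?(ltW y0)//= ler_pdivrMr ?mul1r.
rewrite -[x in phi x](divfK (lt0r_neq0 y0)).
rewrite (le_trans (power_type_scale_le (ltW y0) t01))//.
by rewrite ler_piMl ?phi_ge0 ?(ltW y0)//; case/andP: t01.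
Qed.

Lemma power_type_doubling : exists2 K : R, 1 <= K &
  forall x, 0 <= x -> phi (2 * x) <= K * phi x.
Proof.
have [K hK] : exists K : R, forall x, 0 < x -> phi (2 * x) / phi x <= K.
  by case: phiP.
exists (Num.max 1 K); first by rewrite le_max lexx.
move=> x; rewrite le_eqVlt => /predU1P[<-|x0]; first by rewrite mulr0 phi0 mulr0.
rewrite -ler_pdivrMr ?phi_gt0//; apply: (le_trans (hK _ x0)).
by rewrite le_max lexx orbT.
Qed.

(** If [v <= s * u], convexity along [(1 + s) * u = s * (2 * u) + (1 - s) * u] and doubling cost
    only the factor [1 + s * (K - 1)], and [s * K <= eta]. Otherwise [u + v] is at most a fixed
    multiple of [v], and doubling is iterated. *)
Lemma power_type_weak_triangle (eta : R) : 0 < eta ->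
  exists2 C, 0 <= C & forall u v, 0 <= u -> 0 <= v ->
    phi (u + v) <= (1 + eta) * phi u + C * phi v.
Proof.
move=> eta0; have [K K1 hK] := power_type_doubling.
have K0 : 0 < K by rewrite (lt_le_trans _ K1).
have hKn n x : 0 <= x -> phi (2 ^+ n * x) <= K ^+ n * phi x.
  elim: n => [|n ih] x0; first by rewrite !expr0 !mul1r.
  rewrite exprS -mulrA (le_trans (hK _ _)) ?mulr_ge0 ?exprn_ge0//.
  by rewrite exprS -mulrA ler_pM2l// ih.
pose s := Num.min 1 (eta / K).
have s0 : 0 < s by rewrite lt_min ltr01 divr_gt0.
have s1 : s <= 1 by rewrite ge_min lexx.
have sK : s * K <= eta by rewrite -ler_pdivlMr// ge_min lexx orbT.
pose n := Num.Def.truncn (1 + s^-1).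
have hn : 1 + s^-1 <= 2 ^+ n.+1.
  rewrite (@le_trans _ _ n.+1%:R)//; first by rewrite ltW// truncnS_gt.
  by rewrite -natrX ler_nat ltnW// ltn_expl.
exists (K ^+ n.+1); first by rewrite exprn_ge0// ltW.
move=> u v u0 v0; have [vsu|suv] := leP v (s * u).
  have := @phi_conv (2 * u) u s; rewrite mulr_ge0// u0 (ltW s0) s1.
  move=> /(_ erefl erefl erefl) h.
  have h2 : phi (u + v) <= phi (s * (2 * u) + (1 - s) * u).
    by apply: power_type_nondecreasing; [rewrite addr_ge0|lra].
  rewrite (le_trans h2)// (le_trans h)//.
  apply: (@le_trans _ _ ((1 + eta) * phi u)); last first.
    by rewrite lerDl mulr_ge0 ?exprn_ge0 ?phi_ge0 ?(ltW K0).
  apply: (@le_trans _ _ (s * (K * phi u) + (1 - s) * phi u)).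
    by rewrite lerD2r ler_pM2l// hK.
  rewrite mulrA -mulrDl ler_wpM2r ?phi_ge0//; lra.
apply: (@le_trans _ _ (K ^+ n.+1 * phi v)); last first.
  by rewrite lerDr mulr_ge0 ?phi_ge0// addr_ge0// ltW.
rewrite (le_trans _ (hKn n.+1 _ v0))// power_type_nondecreasing ?addr_ge0//.
rewrite (@le_trans _ _ ((1 + s^-1) * v))//; last by rewrite ler_wpM2r.
by rewrite mulrDl mul1r addrC lerD2l mulrC ler_pdivlMr// mulrC ltW.
Qed.

(** By convexity the difference quotients are nondecreasing in the step [h]. The chord from 0 to
    [x + h] bounds them below by [phi x / x]; the step [h = x] bounds their limit above through
    doubling. *)
Let right_deriv_bounds x : 0 < x ->
  phi x <= x * right_deriv phi x /\
  forall K, phi (2 * x) <= K * phi x -> x * right_deriv phi x <= (K - 1) * phi x.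
Proof.
move=> x0; pose q h := (phi (x + h) - phi x) / h.
have qnd h k : 0 < h -> h <= k -> q h <= q k.
  move=> h0 hk; have k0 := lt_le_trans h0 hk.
  have t01 : 0 <= h / k <= 1.
    by rewrite divr_ge0 ?(ltW k0) ?(ltW h0)//= ler_pdivrMr ?mul1r.
  have xk : 0 <= x + k by rewrite addr_ge0 ?(ltW x0) ?(ltW k0).
  have := phi_conv xk (ltW x0) t01.
  have -> : h / k * (x + k) + (1 - h / k) * x = x + h.
    by field; rewrite gt_eqF.
  move=> h1; rewrite /q ler_pdivrMr// mulrAC mulrC mulrA.
  by rewrite -(mulrC (_ - _)) lerBlDr; move: h1; lra.
have qlb h : 0 < h -> phi x / x <= q h.
  move=> h0; have xh : 0 < x + h by rewrite addr_gt0.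
  have t01 : 0 <= x / (x + h) <= 1.
    by rewrite divr_ge0 ?(ltW x0) ?(ltW xh)//= ler_pdivrMr// mul1r lerDl ltW.
  have := power_type_scale_le (ltW xh) t01.
  rewrite divfK ?gt_eqF// mulrAC ler_pdivlMr// => hx.
  by rewrite /q ler_pdivrMr// mulrAC ler_pdivlMr//; move: hx; lra.
have qcvg : cvg (q h @[h --> 0^'+]).
  apply: nondecreasing_at_right_is_cvgr.
    apply: nearW => y h k; rewrite !in_itv/= => /andP[h0 _] _; exact: qnd.
  apply: nearW => y; exists (phi x / x) => _ [h + <-].
  by rewrite /= in_itv/= => /andP[h0 _]; exact: qlb.
split.
  rewrite mulrC -ler_pdivrMr//; apply: limr_ge => //.
  by near=> h; apply: qlb; near: h; exact: nbhs_right_gt.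
move=> K hK; rewrite mulrC -ler_pdivlMr//; apply: limr_le => //.
near=> h; have h0 : 0 < h by near: h; exact: nbhs_right_gt.
have hx : h <= x by near: h; exact: nbhs_right_le.
rewrite (le_trans (qnd _ _ h0 hx))// /q ler_pM2r ?invr_gt0//.
have -> : x + x = 2 * x by rewrite mulr_natl mulr2n.
by rewrite mulrBl mul1r lerD2r.
Unshelve. all: by end_near. Qed.

(** Doubling bounds the set by [K - 1]; without an upper bound [sup] would return its default value
    0. Positivity of the exponent is what lets the root in [dtilde] be undone. *)
Lemma cost_exponent_ge1 : 1 <= cost_exponent phi.
Proof.
have [K K1 hK] := power_type_doubling.
apply: (@le_trans _ _ (1 * right_deriv phi 1 / phi 1)).
  by rewrite ler_pdivlMr ?phi_gt0// !mul1r; have [] := right_deriv_bounds ltr01; rewrite mul1r.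
apply: ub_le_sup; last by exists 1 => //=.
exists (K - 1) => _ [x /= x0 <-]; rewrite ler_pdivrMr ?phi_gt0//.
by case: (right_deriv_bounds x0) => _; apply; rewrite hK// ltW.
Qed.

End power_type_theory.

(** * Relative entropy, densities and Young's inequality *)

Section entropy.
Context {d} {X : measurableType d} {R : realType}.
Implicit Types (mu nu : probability X R) (f : X -> R).
Local Open Scope ereal_scope.

(** A real-valued, everywhere nonnegative version of the density, known only through its change of
    variables formula. *)
Definition is_density mu nu f : Prop :=
  [/\ measurable_fun setT f, (forall x, (0 <= f x)%R) &
      forall u : X -> \bar R, measurable_fun setT u -> (forall x, 0 <= u x) ->
        \int[nu]_x u x = \int[mu]_x (u x * (f x)%:E)].

(** [relative_entropy] uses the derivative of [nu] seen as a charge. It is exchanged for the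
    nonnegative finite version; the two agree off a [mu]-null set, which [nu] neglects too. *)
Lemma dominated_entropy_density mu nu : nu `<< mu ->
  exists2 f, is_density mu nu f &
    relative_entropy mu nu = \int[nu]_x (ln (f x))%:E.
Proof.
move=> numu; pose F := Radon_Nikodym_SigmaFinite.f nu mu.
have mF : measurable_fun setT F.
  exact: measurable_int (Radon_Nikodym_SigmaFinite.f_integrable numu).
have F0 := Radon_Nikodym_SigmaFinite.f_ge0 numu.
have Ffin := Radon_Nikodym_SigmaFinite.f_fin_num numu.
have mf : measurable_fun setT (fine \o F) by exact: measurableT_comp.
exists (fine \o F).
  split => //; first by move=> x; exact: fine_ge0.
  move=> u mu_ u0; rewrite -(Radon_Nikodym_SigmaFinite.change_of_variables numu)//.
  by apply: eq_integral => x _ /=; rewrite fineK.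
rewrite /relative_entropy; case: pselect => //= _.
apply: ae_eq_integral => //.
- apply/measurable_EFinP; apply: measurableT_comp; first exact: measurable_ln.
  by apply: measurableT_comp => //; apply: measurable_int; exact: Radon_Nikodym_integrable.
- by apply/measurable_EFinP; apply: measurableT_comp => //; exact: measurable_ln.
have [N [mN N0 sN]] := ae_eq_Radon_Nikodym_SigmaFinite numu measurableT.
exists N; split => //.
  exact: (null_content_dominatesP _ _).1 numu _ mN N0.
by apply: subset_trans sN => x /= + h; apply => _; rewrite -h.
Qed.

Lemma entropy_dominates mu nu : relative_entropy mu nu < +oo -> nu `<< mu.
Proof. by rewrite /relative_entropy; case: pselect. Qed.

(** The factor is [1 / f], so the left side integrates [u] over the set where [f] is positive. Where
    [f] vanishes, the convention [ln 0 = 0] makes the factor 1, but the density kills it. *)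
Lemma density_integral_expN mu nu f (u : X -> \bar R) : is_density mu nu f ->
  measurable_fun setT u -> (forall x, 0 <= u x) ->
  \int[nu]_x (u x * (expR (- ln (f x)))%:E) <= \int[mu]_x u x.
Proof.
move=> [mf f0 fE] mu_ u0.
have me : measurable_fun setT (fun x => (expR (- ln (f x)))%:E).
  apply/measurable_EFinP; apply: measurableT_comp; first exact: measurable_expR.
  by apply: measurableT_comp => //; apply: measurableT_comp => //; exact: measurable_ln.
rewrite fE; last 2 first.
  by apply: emeasurable_funM.
  by move=> x; rewrite mule_ge0// lee_fin expR_ge0.
apply: ge0_le_integral => //.
- by move=> x _; rewrite !mule_ge0// lee_fin ?expR_ge0.
- by apply: emeasurable_funM; [exact: emeasurable_funM|exact/measurable_EFinP].
move=> x _; rewrite -muleA -EFinM -[leRHS]mule1 lee_wpmul2l// lee_fin.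
have := f0 x; rewrite le_eqVlt => /predU1P[<-|fx0]; first by rewrite mulr0.
by rewrite expRN lnK ?posrE// mulVf// gt_eqF.
Qed.

(** The negative part of [ln f] is at most [1 / f], whose [nu]-integral is at most 1. An infinite
    positive part would then make the whole integral infinite. *)
Lemma density_ln_integrable mu nu f : is_density mu nu f ->
  \int[nu]_x (ln (f x))%:E < +oo -> nu.-integrable setT (fun x => (ln (f x))%:E).
Proof.
move=> fD; have [mf f0 fE] := fD.
have ml : measurable_fun setT (fun x => (ln (f x))%:E).
  by apply/measurable_EFinP; apply: measurableT_comp => //; exact: measurable_ln.
have hneg : \int[nu]_x ((fun x => (ln (f x))%:E)^\- x) <= 1.
  rewrite (le_trans _ (_ : \int[mu]_x cst 1%E x <= 1))//; last first.
    by rewrite integral_cst//= probability_setT mule1.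
  rewrite (le_trans _ (density_integral_expN fD _ _))//.
  apply: ge0_le_integral => //.
  - exact: measurable_funeneg.
  - apply/measurable_EFinP; apply: measurable_funM => //.
    apply: measurableT_comp; first exact: measurable_expR.
    by apply: measurableT_comp => //; exact/measurable_EFinP.
  - move=> x _; rewrite mul1e funenegE -EFinN -EFin_max lee_fin ge_max expR_ge0 andbT.
    by rewrite (le_trans _ (expR_ge1Dx _))// lerDr.
rewrite integralE => hlt.
have negfin : \int[nu]_x ((fun x => (ln (f x))%:E)^\- x) \is a fin_num.
  by rewrite ge0_fin_numE ?(le_lt_trans hneg) ?ltry// integral_ge0.
apply/integrableP; split => //.
rewrite (eq_integral ((fun x => (ln (f x))%:E)^\+ \+ (fun x => (ln (f x))%:E)^\-)); last first.
  by move=> x _; have /(congr1 (@^~ x))/= <- := fune_abse (fun x => (ln (f x))%:E).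
rewrite ge0_integralD//; [|exact: measurable_funepos|exact: measurable_funeneg].
apply: lte_add_pinfty; last by rewrite (le_lt_trans hneg) ?ltry.
rewrite ltey; apply: contraTN hlt => /eqP ->; rewrite -leNgt.
by case: (\int[nu]_x ((fun x => (ln (f x))%:E)^\- x)) negfin.
Qed.

Lemma finite_entropy_density mu nu : relative_entropy mu nu < +oo ->
  exists f, [/\ is_density mu nu f,
    nu.-integrable setT (fun x => (ln (f x))%:E) &
    relative_entropy mu nu = \int[nu]_x (ln (f x))%:E].
Proof.
move=> H; have [f fD fE] := dominated_entropy_density (entropy_dominates H).
by exists f; split => //; apply: (density_ln_integrable fD); rewrite -fE.
Qed.

Lemma entropy_fin_num mu nu : relative_entropy mu nu < +oo ->
  relative_entropy mu nu \is a fin_num.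
Proof.
by move=> /finite_entropy_density[f [_ fi ->]]; exact: integrable_fin_num.
Qed.

(* Young's inequality [h <= ln f - 1 + e^h / f], integrated against [nu]. *)
Lemma entropy_young mu nu (h : X -> R) (B : R) : relative_entropy mu nu < +oo ->
  measurable_fun setT h -> (forall x, (- B <= h x)%R) ->
  \int[mu]_x (expR (h x))%:E < +oo ->
  nu.-integrable setT (EFin \o h) /\
  \int[nu]_x (h x)%:E + 1 <= relative_entropy mu nu + \int[mu]_x (expR (h x))%:E.
Proof.
move=> H mh hB hoo; have [f [fD fi ->]] := finite_entropy_density H.
have [mf f0 _] := fD.
have ml : measurable_fun setT (fun x => ln (f x)).
  by apply: measurableT_comp => //; exact: measurable_ln.
pose w x := (expR (h x) * expR (- ln (f x)))%R.
have hyoung x : (h x + 1 <= ln (f x) + w x)%R.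
  by rewrite /w -expRD; have := expR_ge1Dx (h x - ln (f x)); lra.
have w0 x : (0 <= w x)%R by rewrite mulr_ge0// expR_ge0.
have mw : measurable_fun setT w.
  apply: measurable_funM; apply: measurableT_comp; try exact: measurable_expR.
    by [].
  exact: measurableT_comp.
have wle : \int[nu]_x (w x)%:E <= \int[mu]_x (expR (h x))%:E.
  apply: le_trans (density_integral_expN fD (u := fun x => (expR (h x))%:E) _ _) => //.
  by apply/measurable_EFinP; apply: measurableT_comp => //; exact: measurable_expR.
have wi : nu.-integrable setT (EFin \o w).
  apply/integrableP; split; first exact/measurable_EFinP.
  rewrite (le_lt_trans _ hoo)// (le_trans _ wle)// le_eqVlt; apply/orP; left; apply/eqP.
  by apply: eq_integral => x _ /=; rewrite ger0_norm.
have ci c : nu.-integrable setT (EFin \o @cst X R c).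
  exact: finite_measure_integrable_cst.
have hi : nu.-integrable setT (EFin \o h).
  (* A dominating function for [h]: the upper side is [hyoung], the lower side is the assumed bound
     [- B]. *)
  pose b x := (`|ln (f x)| + w x + `|B|)%R.
  apply: (@le_integrable _ _ _ _ _ _ _ (EFin \o b)) => //.
  - exact/measurable_EFinP.
  - move=> x _; rewrite /= lee_fin; have := hyoung x; have := hB x.
    have : (ln (f x) <= `|ln (f x)|)%R by exact: ler_norm.
    have := ler_norm B; rewrite ler_norml => h1 h2 h3 h4.
    have b0 : (0 <= b x)%R by rewrite /b !addr_ge0.
    have lN : (0 <= `|ln (f x)|)%R by [].
    have BN : (0 <= `|B|)%R by [].
    by have := w0 x; rewrite (ger0_norm b0) /b => wx; apply/andP; split; lra.
  - rewrite (_ : EFin \o b =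
      ((fun x => `|(ln (f x))%:E|) \+ (EFin \o w)) \+ (EFin \o cst `|B|%R))//.
    by apply: integrableD => //; apply: integrableD => //; exact: integrable_abse.
split => //.
rewrite -(mule1 1%E) -{2}(@probability_setT _ _ _ nu) -integral_cst//.
rewrite -integralD//; last exact: (ci 1%R).
rewrite (le_trans _ (leeD2l _ wle))// -integralD//.
apply: le_integral => //.
- by apply: integrableD => //; exact: (ci 1%R).
- exact: integrableD.
- by move=> x _; rewrite /= -EFinD lee_fin.
Qed.

Lemma entropy_ge0 mu nu : 0 <= relative_entropy mu nu.
Proof.
have [H|] := ltP (relative_entropy mu nu) +oo; last exact: le_trans.
have E1 : \int[mu]_x (expR 0)%:E = 1 :> \bar R.
  by rewrite expR0 integral_cst//= probability_setT mul1e.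
have := @entropy_young mu nu (cst 0%R) 0 H.
case=> //; [by move=> x; rewrite oppr0|by rewrite E1 ltry|].
by move=> _; rewrite E1 integral0 add0e -leeBlDr// subee.
Qed.

Lemma density_integral1 mu nu f : is_density mu nu f -> \int[mu]_x (f x)%:E = 1.
Proof.
move=> [mf f0 fE]; have := fE (cst 1%E) (measurable_cst _) (fun _ => lee01).
rewrite integral_cst//= probability_setT mul1e => ->.
by apply: eq_integral => x _; rewrite mul1e.
Qed.

(** The density of [mu] with respect to itself need not be identified with 1: [ln f <= f] and [f]
    has integral 1. *)
Lemma entropy_refl_lty mu : relative_entropy mu mu < +oo.
Proof.
have [f fD ->] := @dominated_entropy_density mu mu (fun A h => h).
have [mf f0 _] := fD.
have mle : measurable_fun setT (fun x => (ln (f x))%:E).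
  by apply/measurable_EFinP; apply: measurableT_comp => //; exact: measurable_ln.
rewrite integralE; apply: (@le_lt_trans _ _ (\int[mu]_x (f x)%:E)); last first.
  by rewrite (density_integral1 fD) ltry.
apply: (@le_trans _ _ (\int[mu]_x ((fun x => (ln (f x))%:E)^\+ x))).
  by rewrite -[leRHS]adde0 leeD2l// oppe_le0 integral_ge0.
apply: ge0_le_integral => //.
- exact: measurable_funepos.
- exact/measurable_EFinP.
move=> x _; rewrite funeposE -EFin_max lee_fin ge_max f0 andbT.
have := f0 x; rewrite le_eqVlt => /predU1P[<-|fx0]; first by rewrite ln0.
by rewrite ltW// ln_sublinear.
Qed.

(** Young's inequality with [h = K * \1_A], whose exponential is at most [1 + expR K * \1_A]. Taking
    [K] large, then [mu A] small, makes [nu A] small uniformly over all [nu] of bounded entropy. *)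
Lemma entropy_equiintegrable mu nu (K : R) (A : set X) : (0 <= K)%R ->
  measurable A -> relative_entropy mu nu < +oo ->
  K%:E * nu A <= relative_entropy mu nu + (expR K)%:E * mu A.
Proof.
move=> K0 mA H; pose h x : R := (K * \1_A x)%R.
have mh : measurable_fun setT h.
  by apply: measurable_funM => //; exact: measurable_indic.
have mI : measurable_fun setT (fun x => (\1_A x : R)%:E).
  by apply/measurable_EFinP; exact: measurable_indic.
have hle : \int[mu]_x (expR (h x))%:E <= 1 + (expR K)%:E * mu A.
  have E1 : 1 = \int[mu]_x cst 1 x.
    by rewrite integral_cst//= probability_setT mul1e.
  have E2 : mu A = \int[mu]_x (\1_A x)%:E by rewrite integral_indic// setIT.
  rewrite E1 E2 -ge0_integralZl//.
  rewrite -ge0_integralD//; last exact: measurable_funeM.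
  apply: ge0_le_integral => //.
  - by apply/measurable_EFinP; apply: measurableT_comp => //; exact: measurable_expR.
  - by apply: emeasurable_funD => //; exact: measurable_funeM.
  - move=> x _; rewrite /h /= indicE; case: (x \in A) => /=.
      by rewrite mulr1 mule1 -EFinD lee_fin lerDr.
    by rewrite mulr0 expR0 mule0 adde0.
have [] := @entropy_young mu nu h 0 H mh.
- by move=> x; rewrite oppr0 mulr_ge0.
- rewrite (le_lt_trans hle)// lte_add_pinfty ?ltry//.
  by rewrite lte_mul_pinfty// ?lee_fin ?expR_ge0// (le_lt_trans (probability_le1 _ _))// ltry.
move=> _; have -> : \int[nu]_x (h x)%:E = K%:E * nu A.
  under eq_integral do rewrite EFinM.
  rewrite ge0_integralZl//.
  by rewrite integral_indic// setIT.
move=> h1; have := le_trans h1 (leeD2l _ hle).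
by rewrite addeCA [leRHS]addeC leeD2rE.
Qed.

(** The density is clipped before the logarithm is taken, so the argument stays positive and the
    convention [ln 0 = 0] never interferes. *)
Definition clip_ln (lo hi : R) f (x : X) : R :=
  ln (Num.max (expR lo) (Num.min (f x) (expR hi))).

Lemma clip_ln_measurable lo hi f : measurable_fun setT f ->
  measurable_fun setT (clip_ln lo hi f).
Proof.
move=> mf; apply: measurableT_comp; first exact: measurable_ln.
by apply: measurable_maxr => //; apply: measurable_minr.
Qed.

Let clip_gt0 lo hi f x : (0 < Num.max (expR lo) (Num.min (f x) (expR hi)))%R.
Proof. by rewrite lt_max expR_gt0. Qed.

Lemma clip_ln_ge lo hi f x : (lo <= clip_ln lo hi f x)%R.
Proof.
by rewrite -[leLHS]expRK ler_ln ?posrE ?expR_gt0// le_max lexx.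
Qed.

Lemma clip_ln_le lo hi f x : (lo <= hi)%R -> (clip_ln lo hi f x <= hi)%R.
Proof.
move=> lohi; rewrite -[leRHS]expRK ler_ln ?posrE ?expR_gt0//.
by rewrite ge_max ler_expR lohi ge_min lexx orbT.
Qed.

(** The clipped density is at most [f + expR lo]. This bounds the exponential term of Young's
    inequality by almost 1 when [lo] is very negative. *)
Lemma integral_exp_clip_ln mu nu f lo hi : is_density mu nu f ->
  \int[mu]_x (expR (clip_ln lo hi f x))%:E <= 1 + (expR lo)%:E.
Proof.
move=> fD; have [mf f0 _] := fD.
rewrite -(density_integral1 fD) -[X in _ + X]mule1 -{1}(@probability_setT _ _ _ mu).
rewrite -integral_cst// -ge0_integralD//; last 3 first.
- by move=> x _; rewrite lee_fin.
- exact/measurable_EFinP.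
- by move=> x _; rewrite lee_fin expR_ge0.
apply: ge0_le_integral => //.
- apply/measurable_EFinP; apply: measurableT_comp; first exact: measurable_expR.
  exact: clip_ln_measurable.
- by apply: emeasurable_funD => //; exact/measurable_EFinP.
move=> x _; rewrite -EFinD lee_fin lnK ?posrE// ge_max lerDr f0/=.
by rewrite (@le_trans _ _ (f x))// ?ge_min ?lexx// lerDl expR_ge0.
Qed.

(** For [lo = 0] the clipped logarithms increase to the logarithm of the maximum of 1 and [f], which
    dominates the positive part of [ln f]. Monotone convergence carries the bound over, and the
    negative part only lowers the integral. *)
Lemma entropy_lty_of_clip mu nu f (M : R) : is_density mu nu f ->
  relative_entropy mu nu = \int[nu]_x (ln (f x))%:E ->
  (forall k : nat, \int[nu]_x (clip_ln 0 k%:R f x)%:E <= M%:E) ->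
  relative_entropy mu nu < +oo.
Proof.
move=> [mf f0 _] -> hM; pose p k x := (clip_ln 0 k%:R f x)%:E.
have mp k : measurable_fun setT (p k).
  by apply/measurable_EFinP; exact: clip_ln_measurable.
have p0 k x : setT x -> 0 <= p k x by move=> _; rewrite lee_fin clip_ln_ge.
have pnd x : setT x -> {homo p^~ x : n m / (n <= m)%N >-> n <= m}.
  move=> _ n m nm; rewrite lee_fin ler_ln ?posrE// ge_max le_max lexx/=.
  rewrite le_max; apply/orP; right; rewrite le_min ge_min lexx/= ge_min.
  by rewrite ler_expR ler_nat nm orbT.
have plim x : limn (p^~ x) = (ln (Num.max 1 (f x)))%:E.
  apply/cvg_lim => //; apply: cvg_near_cst; near=> k; rewrite /p /clip_ln expR0.
  congr (ln (Num.max _ _))%:E; apply/min_idPl.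
  rewrite (@le_trans _ _ k%:R)//; first by near: k; exact: nbhs_infty_ger.
  by rewrite (le_trans _ (expR_ge1Dx _))// lerDr.
have := cvg_monotone_convergence measurableT mp p0 pnd (mu := nu).
move=> /cvge_to_le -/(_ M%:E) hle.
have {}hle : \int[nu]_x (ln (Num.max 1 (f x)))%:E <= M%:E.
  by under eq_integral do rewrite -plim; apply: hle; apply: nearW.
rewrite integralE (le_lt_trans _ (ltry M))//.
rewrite (le_trans _ hle)//.
apply: (@le_trans _ _ (\int[nu]_x ((fun x => (ln (f x))%:E)^\+ x))).
  by rewrite -[leRHS]adde0 leeD2l// oppe_le0 integral_ge0.
apply: ge0_le_integral => //.
- apply: measurable_funepos; apply/measurable_EFinP.
  by apply: measurableT_comp => //; exact: measurable_ln.
- apply/measurable_EFinP; apply: measurableT_comp; first exact: measurable_ln.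
  exact: measurable_maxr.
move=> x _; rewrite funeposE -EFin_max lee_fin ge_max; apply/andP; split.
  have [fx0|fx0] := leP (f x) 0%R; last first.
    by rewrite ler_ln ?posrE ?lt_max ?ltr01// le_max lexx orbT.
  by rewrite ln0// ln_ge0// le_max lexx.
by rewrite ln_ge0// le_max lexx.
Unshelve. all: by end_near. Qed.

Lemma clip_ln_cvg_entropy mu nu f : is_density mu nu f ->
  nu.-integrable setT (fun x => (ln (f x))%:E) ->
  \int[nu]_x (clip_ln (- k%:R) k%:R f x)%:E @[k --> \oo] -->
    \int[nu]_x (ln (f x))%:E.
Proof.
move=> fD fi; have [mf f0 fE] := fD.
have ml : measurable_fun setT (fun x => (ln (f x))%:E).
  by apply/measurable_EFinP; apply: measurableT_comp => //; exact: measurable_ln.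
(* Where [f] vanishes the clipped logarithm is [- k%:R] while [ln] gives 0, so convergence fails
   there; this set is [nu]-null because its [nu]-mass is an integral of [f] over it. *)
have fpos : {ae nu, forall x, (0 < f x)%R}.
  exists (f @^-1` [set 0%R]); split.
  - by rewrite -[X in measurable X]setTI; exact: mf.
  - have mZ : measurable (f @^-1` [set 0%R]).
      by rewrite -[X in measurable X]setTI; exact: mf.
    rewrite -(setIT (f @^-1` _)) -integral_indic// fE//; last first.
      by apply/measurable_EFinP; exact: measurable_indic.
    apply: integral0_eq => x _; rewrite indicE; case: (boolP (_ \in _)).
      by rewrite inE/= => ->; rewrite mule0.
    by rewrite mul0e.
  - by move=> x /= /negP; rewrite -leNgt => h; apply/eqP; rewrite eq_le h f0.
have [] := @dominated_convergence _ _ _ nu setT measurableT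
  (fun k x => (clip_ln (- k%:R) k%:R f x)%:E) (fun x => (ln (f x))%:E)
  (fun x => `|(ln (f x))%:E|).
- by move=> k; apply/measurable_EFinP; exact: clip_ln_measurable.
- by [].
- apply: filterS fpos => x fx0 _; apply: cvg_near_cst; near=> k.
  congr (ln _)%:E.
  have hk : (`|ln (f x)| <= k%:R)%R by near: k; exact: nbhs_infty_ger.
  move: hk; rewrite ler_norml => /andP[h1 h2].
  have -> : (Num.min (f x) (expR k%:R) = f x)%R.
    by apply/min_idPl; rewrite -[leLHS]lnK ?posrE// ler_expR.
  by apply/max_idPr; rewrite -[leRHS]lnK ?posrE// ler_expR.
- exact: integrable_abse.
- apply: filterS fpos => x fx0 k _; rewrite lee_fin.
  rewrite /clip_ln; have [h|h] := leP (expR k%:R) (f x).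
    rewrite max_r ?ler_expR; last by rewrite (@le_trans _ _ 0%R)// oppr_le0.
    rewrite expRK ger0_norm// (le_trans _ (ler_norm _))//.
    by rewrite -[leLHS]expRK ler_ln ?posrE ?expR_gt0.
  have [h2|h2] := leP (expR (- k%:R)) (f x); first by [].
  rewrite expRK normrN (ger0_norm (ler0n _ _)) -normrN (le_trans _ (ler_norm _))//.
  by rewrite lerNr -[leRHS]expRK ler_ln ?posrE ?expR_gt0// ltW.
by [].
Unshelve. all: by end_near. Qed.

End entropy.

(** * Construction of finite measures and probabilities *)

Section measure_packing.
Context {d} {X : measurableType d} {R : realType}.
Local Open Scope ereal_scope.

(** The proof [h] is an argument of the alias so that the alias can carry a structure that [m] alone
    does not have. *)
Definition finite_of (m : {measure set X -> \bar R}) (h : fin_num_fun m) :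
  set X -> \bar R := m.

Definition probability_of (m : {measure set X -> \bar R}) (h : m setT = 1) :
  set X -> \bar R := m.

Section instances.
Variable m : {measure set X -> \bar R}.

HB.instance Definition _ (h : fin_num_fun m) := Measure.copy (finite_of h) m.
HB.instance Definition _ (h : fin_num_fun m) :=
  Measure_isFinite.Build _ _ _ (finite_of h) h.

HB.instance Definition _ (h : m setT = 1) := Measure.copy (probability_of h) m.
HB.instance Definition _ (h : m setT = 1) :=
  Measure_isProbability.Build _ _ _ (probability_of h) h.

End instances.

Lemma finite_measureP (m : {measure set X -> \bar R}) : fin_num_fun m ->
  exists m' : {finite_measure set X -> \bar R}, m' = m :> (set X -> \bar R).
Proof. by move=> h; exists (finite_of h). Qed.

Lemma probabilityP (m : {measure set X -> \bar R}) : m setT = 1 ->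
  exists m' : probability X R, m' = m :> (set X -> \bar R).
Proof. by move=> h; exists (probability_of h). Qed.

End measure_packing.

Section finite_measure_constructions.
Context {d} {X : measurableType d} {R : realType}.
Local Open Scope ereal_scope.

Lemma finite_measure_lincomb (m1 m2 : {finite_measure set X -> \bar R}) (a b : R) :
  (0 <= a)%R -> (0 <= b)%R ->
  exists m : {finite_measure set X -> \bar R},
    (forall B, m B = a%:E * m1 B + b%:E * m2 B) /\
    (forall f, measurable_fun setT f -> (forall x, 0 <= f x) ->
      \int[m]_x f x = a%:E * \int[m1]_x f x + b%:E * \int[m2]_x f x).
Proof.
move=> a0 b0; pose m := measure_add (mscale (NngNum a0) m1) (mscale (NngNum b0) m2).
have mE B : m B = a%:E * m1 B + b%:E * m2 B by rewrite /m measure_addE.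
have mfin : fin_num_fun m.
  by move=> B mB; rewrite mE fin_numD !fin_numM ?fin_num_measure.
have [m' m'E] := finite_measureP mfin.
exists m'; split => [B|f mf f0]; first by rewrite m'E; exact: mE.
by rewrite m'E /m ge0_integral_measure_add// !ge0_integral_mscale.
Qed.

Lemma ge0_integral_mrestr d' (T : measurableType d') (m : {measure set T -> \bar R})
  (D : set T) (mD : measurable D) (f : T -> \bar R) :
  measurable_fun setT f -> (forall x, 0 <= f x) ->
  \int[mrestr m mD]_x f x = \int[m]_(x in D) f x.
Proof.
move=> mf f0; rewrite -(setUv D) ge0_integral_setU//; last 3 first.
- exact: measurableC.
- by rewrite setUv.
- by apply/disj_setPS => x [].
rewrite [X in _ + X](_ : _ = 0) ?adde0; last first.
  apply: null_set_integral.
  - exact: measurableC.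
  - exact: measurable_funTS.
  - by rewrite /= /mrestr setICl measure0.
by apply: eq_measure_integral => A mA AD; rewrite /= /mrestr setIidl.
Qed.

(** Up to normalization, the law of the second coordinate given that the first lies in [A]: the
    image under [snd] of [p] restricted to the strip above [A]. *)
Lemma measure_slice (p : probability (X * X)%type R) (A : set X) : measurable A ->
  exists s : {finite_measure set X -> \bar R},
    (forall B, s B = p (A `*` B)) /\
    (forall f, measurable_fun setT f -> (forall x, 0 <= f x) ->
      \int[s]_x f x = \int[p]_(z in A `*` setT) f z.2).
Proof.
move=> mA; have mAT : measurable (A `*` [set: X]) by exact: measurableX.
have ms : measurable_fun setT (@snd X X) by exact: measurable_snd.
pose s := measure_function_pushforward__canonical__measure_function_Measure
  (mrestr p mAT) ms.
have sE B : s B = p (A `*` B).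
  rewrite /s/= /pushforward /mrestr; congr (p _).
  by apply/seteqP; split => [[x y]/= [? []]|[x y]/= []].
have sfin : fin_num_fun s.
  by move=> B mB; rewrite sE; apply: fin_num_measure; exact: measurableX.
have [s' s'E] := finite_measureP sfin.
exists s'; split => [B|f mf f0]; first by rewrite s'E; exact: sE.
rewrite s'E [LHS]ge0_integral_pushforward//= preimage_setT ge0_integral_mrestr//.
exact: measurableT_comp.
Qed.

End finite_measure_constructions.

(** * Couplings given by kernels that are constant on cells *)

Section couplings.
Context {d} {X : measurableType d} {R : realType}.
Implicit Types (mu nu : probability X R) (c : X -> X -> R).
Local Open Scope ereal_scope.

Lemma coupling_integral_snd nu mu pi (u : X -> \bar R) : coupling nu mu pi ->
  measurable_fun setT u -> (forall x, 0 <= u x) ->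
  \int[pi]_z u z.2 = \int[mu]_x u x.
Proof.
move=> cp mu_ u0.
have mf : measurable_fun setT (@snd X X) by exact: measurable_snd.
rewrite (@eq_measure_integral _ _ _ setT
  (measure_function_pushforward__canonical__measure_function_Measure pi mf) mu).
  by rewrite [RHS]ge0_integral_pushforward//= preimage_setT.
move=> B mB _; rewrite /= /pushforward -[LHS](cp B mB).2; congr (pi _).
by apply/seteqP; split => [[x y] []|[x y]/=].
Qed.

Lemma probability_partition nu N (A : nat -> set X) B :
  (forall i, measurable (A i)) -> trivIset setT A ->
  \big[setU/set0]_(i < N) A i = setT -> measurable B ->
  \sum_(i < N) nu (B `&` A i) = nu B.
Proof.
move=> mA tA cA mB.
have UE : \big[setU/set0]_(i < N) (B `&` A i) = B by rewrite -big_distrr/= cA setIT.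
have := @measure_semi_additive _ _ _ nu (fun i => B `&` A i) N.
by rewrite UE => ->// => [i|]; [exact: measurableI|exact: trivIset_setIl].
Qed.

Lemma transport_le_mixture c nu mu N (A : nat -> set X)
    (k : nat -> {finite_measure set X -> \bar R}) :
  (forall x y, (0 <= c x y)%R) -> measurable_fun setT (fun z => c z.1 z.2) ->
  (forall i, measurable (A i)) -> trivIset setT A ->
  \big[setU/set0]_(i < N) A i = setT ->
  (forall i, k i setT = 1) ->
  (forall B, measurable B -> \sum_(i < N) nu (A i) * k i B = mu B) ->
  transport_cost c nu mu <= \sum_(i < N) \int[nu]_(x in A i) \int[k i]_y (c x y)%:E.
Proof.
move=> c0 mc mA tA cA k1 kmu.
pose q i := mrestr nu (mA i) \x k i.
pose p := msum q N.
have pE B C : measurable B -> measurable C ->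
    p (B `*` C) = \sum_(i < N) nu (B `&` A i) * k i C.
  move=> mB mC; rewrite /p/= /msum; apply: eq_bigr => i _.
  by rewrite /q/= product_measure1E.
have p1 B : measurable B -> p (B `*` setT) = nu B.
  move=> mB; rewrite pE//; under eq_bigr do rewrite k1 mule1.
  exact: probability_partition.
have p2 B : measurable B -> p (setT `*` B) = mu B.
  move=> mB; rewrite pE// -(kmu _ mB).
  by apply: eq_bigr => i _; rewrite setTI.
have [P PE] : exists P : probability (X * X)%type R, P = p :> (set _ -> \bar R).
  by apply: probabilityP; have := p1 _ measurableT; rewrite setXTT probability_setT.
apply: (@le_trans _ _ (\int[P]_z (c z.1 z.2)%:E)).
  apply: ereal_inf_lbound; exists P => // B mB.
  by rewrite PE; split; [exact: p1|exact: p2].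
have mcE : measurable_fun setT (fun z => (c z.1 z.2)%:E) by exact/measurable_EFinP.
rewrite PE /p ge0_integral_measure_sum//; last by move=> x _; rewrite lee_fin.
apply: lee_sum => i _; rewrite /q/=.
rewrite fubini_tonelli1//; last by move=> x; rewrite lee_fin.
rewrite [leLHS]ge0_integral_mrestr//.
- apply: (measurable_fun_fubini_tonelli_F (fun z => (c z.1 z.2)%:E)) => //.
  by move=> x; rewrite lee_fin.
- by move=> x; apply: integral_ge0 => y _; rewrite lee_fin.
Qed.

(** The product coupling, seen as a mixture with a single cell. *)
Lemma transport_le_product c nu mu (psi : X -> R) (C : R) :
  (forall x y, (0 <= c x y)%R) -> measurable_fun setT (fun z => c z.1 z.2) ->
  measurable_fun setT psi -> (forall x, (0 <= psi x)%R) -> (0 <= C)%R ->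
  (forall x y, (c x y <= psi x + C * psi y)%R) ->
  transport_cost c nu mu <= \int[nu]_x (psi x)%:E + C%:E * \int[mu]_x (psi x)%:E.
Proof.
move=> c0 mc mpsi psi0 C0 cle.
pose A i : set X := if i is 0%N then setT else set0.
have mA i : measurable (A i) by rewrite /A; case: i.
have tA : trivIset setT A.
  by apply/trivIsetP => -[|i] [|j] //= _ _ _; rewrite ?setI0 ?set0I.
have cA : \big[setU/set0]_(i < 1) A i = setT by rewrite big_ord_recl big_ord0 setU0.
pose k : nat -> {finite_measure set X -> \bar R} := fun=> mu.
have k1 i : k i setT = 1 by exact: probability_setT.
have kmu B : measurable B -> \sum_(i < 1) nu (A i) * k i B = mu B.
  by move=> mB; rewrite big_ord_recl big_ord0/= adde0 probability_setT mul1e.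
apply: (le_trans (transport_le_mixture c0 mc mA tA cA k1 kmu)).
rewrite big_ord_recl big_ord0/= adde0.
have mpsiE : measurable_fun setT (EFin \o psi) by exact/measurable_EFinP.
have psiE0 x : 0 <= (psi x)%:E by rewrite lee_fin.
have I0 : 0 <= \int[mu]_x (psi x)%:E by exact: integral_ge0.
rewrite -[X in _ + X]mule1 -(@probability_setT _ _ _ nu) -integral_cst//.
rewrite -ge0_integralD//; last by move=> x _; rewrite mule_ge0.
apply: ge0_le_integral => //.
- by move=> x _; apply: integral_ge0 => y _; rewrite lee_fin.
- apply: (measurable_fun_fubini_tonelli_F (fun z => (c z.1 z.2)%:E)) => //.
    exact/measurable_EFinP.
  by move=> x; rewrite lee_fin.
- exact: emeasurable_funD.
move=> x _; rewrite -ge0_integralZl//.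
have -> : (psi x)%:E = \int[mu]_y cst (psi x)%:E y.
  by rewrite integral_cst//= probability_setT mule1.
rewrite -ge0_integralD//; last 3 first.
- by move=> y _; exact: psiE0.
- by move=> y _; rewrite mule_ge0.
- exact: measurable_funeM.
apply: ge0_le_integral => //.
- by move=> y _; rewrite lee_fin.
- apply/measurable_EFinP; exact: (measurableT_comp mc (pair1_measurable x)).
- by apply: emeasurable_funD => //; exact: measurable_funeM.
- by move=> y _; rewrite -EFinM -EFinD lee_fin.
Qed.

End couplings.

(* The cells [A i], [i < N], are small and [A N] is the rest. A point [x] of
   [A i] is coupled with [y] drawn from [pi] restricted to [A i * X], except for a
   fraction of the mass that is coupled with the leftover of the second marginal:
   with [sigma_i B = pi (A i * B)], [sigma = e mu + (1 - e) sigma_N] and [theta] its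
   mass, the transition is [alpha_i / nu'(A i) sigma_i + beta_i / theta sigma].
   If [nu'(A i) = 0] then [alpha i * nu (A i) = 0], so the division is harmless. *)
Section gluing.
Context {d} {X : measurableType d} {R : realType}.
Variables (nu nu' mu : probability X R) (pi : probability (X * X)%type R).
Variables (N : nat) (A : nat -> set X) (e : R).
Hypothesis cpi : coupling nu mu pi.
Hypothesis mA : forall i, measurable (A i).
Hypothesis tA : trivIset setT A.
Hypothesis cA : \big[setU/set0]_(i < N.+1) A i = setT.
Hypothesis e01 : 0 < e < 1.
Hypothesis nu'_ge : forall i, (i < N)%N -> ((1 - e)%:E * nu (A i) <= nu' (A i))%E.

Let m i := fine (nu (A i)).
Let m' i := fine (nu' (A i)).
Let alpha i : R := if (i < N)%N then 1 - e else 0.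
Let beta i := 1 - alpha i * m i / m' i.
Let theta := e + (1 - e) * m N.

Let e_gt0 : 0 < e. Proof. by case/andP: e01. Qed.
Let e_lt1 : e < 1. Proof. by case/andP: e01. Qed.
Let mE i : nu (A i) = (m i)%:E. Proof. by rewrite fineK// fin_num_measure. Qed.
Let m'E i : nu' (A i) = (m' i)%:E. Proof. by rewrite fineK// fin_num_measure. Qed.
Let m_ge0 i : 0 <= m i. Proof. by rewrite fine_ge0. Qed.
Let m'_ge0 i : 0 <= m' i. Proof. by rewrite fine_ge0. Qed.

Let alpha_ge0 i : 0 <= alpha i.
Proof. by rewrite /alpha; case: ifP => // _; rewrite subr_ge0 ltW. Qed.

Let alpha_m i : alpha i * m i <= m' i.
Proof.
rewrite /alpha; case: ifP => [iN|_]; last by rewrite mul0r.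
by have := nu'_ge iN; rewrite mE m'E -EFinM lee_fin.
Qed.

Let sum_m : \sum_(i < N.+1) m i = 1.
Proof.
have := probability_partition nu mA tA cA measurableT.
under eq_bigr do rewrite setTI mE.
by rewrite sumEFin probability_setT => -[].
Qed.

Let sum_m' : \sum_(i < N.+1) m' i = 1.
Proof.
have := probability_partition nu' mA tA cA measurableT.
under eq_bigr do rewrite setTI m'E.
by rewrite sumEFin probability_setT => -[].
Qed.

Let theta_gt0 : 0 < theta.
Proof. by rewrite /theta ltr_wpDr// mulr_ge0// subr_ge0 ltW. Qed.

Let beta_m' i : m' i * beta i = m' i - alpha i * m i.
Proof.
rewrite /beta; have [m'0|m'0] := eqVneq (m' i) 0; last by field.
have := alpha_m i; rewrite m'0 => am0.
have -> : alpha i * m i = 0 by apply/eqP; rewrite eq_le am0 mulr_ge0.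
by rewrite mul0r subr0.
Qed.

Let beta_ge0 i : 0 <= beta i.
Proof.
rewrite /beta subr_ge0; have [m'0|m'0] := eqVneq (m' i) 0.
  by rewrite m'0 invr0 mulr0.
by rewrite ler_pdivrMr ?mul1r ?alpha_m// lt0r m'0 m'_ge0.
Qed.

Let sum_alpha (b : nat -> R) :
  \sum_(i < N.+1) alpha i * b i = (1 - e) * \sum_(i < N) b i.
Proof.
rewrite big_ord_recr/= {2}/alpha ltnn mul0r addr0 mulr_sumr.
by apply: eq_bigr => i _; rewrite /alpha ltn_ord.
Qed.

(** This explains [theta]: the mass not coupled within the cells is [1 - (1 - e) * (1 - m N)]. It is
    also the mass of [sigma], so the leftovers of the two marginals match. *)
Let sum_beta : \sum_(i < N.+1) m' i * beta i = theta.
Proof.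
under eq_bigr do rewrite beta_m'.
rewrite sumrB sum_m' sum_alpha /theta.
by move: sum_m; rewrite big_ord_recr/= => /(canRL (addrK _)) ->; ring.
Qed.

(** Weighted by [nu' (A i)], the kernels add up to [1 - e] times the sum of the [sigma_i] with
    [i < N], plus [sigma]. As [sigma] is [e] times [mu] plus [1 - e] times [sigma_N], and all the
    [sigma_i] add up to [mu], the total is [mu]. *)
Let glue_kernel :
  exists k : nat -> {finite_measure set X -> \bar R},
    [/\ forall i, (k i setT = 1)%E,
        forall B, measurable B -> (\sum_(i < N.+1) nu' (A i) * k i B = mu B)%E &
        forall i (u : X -> \bar R), measurable_fun setT u -> (forall x, 0 <= u x)%E ->
          (\int[k i]_y u y =
           (alpha i / m' i)%:E * \int[pi]_(z in A i `*` setT) u z.2 +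
           (beta i / theta)%:E * (e%:E * \int[mu]_y u y +
             (1 - e)%:E * \int[pi]_(z in A N `*` setT) u z.2))%E].
Proof.
have [s hs] := choice (fun i => measure_slice pi (mA i)).
have e1 : 0 <= 1 - e by rewrite subr_ge0 ltW.
have [sg [sgE sgI]] := finite_measure_lincomb mu (s N) (ltW e_gt0) e1.
have a0 i : 0 <= alpha i / m' i by rewrite divr_ge0.
have b0 i : 0 <= beta i / theta by rewrite divr_ge0// ltW.
have [k hk] := choice (fun i => finite_measure_lincomb (s i) sg (a0 i) (b0 i)).
have sT i : s i setT = (m i)%:E by rewrite (hs i).1 (cpi (mA i)).1 mE.
have sgT : sg setT = theta%:E.
  by rewrite sgE sT/= probability_setT mule1 -EFinM -EFinD.
exists k; split.
- move=> i; rewrite (hk i).1 sT sgT -!EFinM -EFinD divfK ?gt_eqF//.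
  by rewrite /beta; congr (_%:E); rewrite mulrAC addrC subrK.
- move=> B mB; pose b i := fine (s i B).
  have bE i : s i B = (b i)%:E by rewrite fineK// fin_num_measure.
  have b_ge0 i : 0 <= b i by rewrite fine_ge0.
  have bm i : b i <= m i.
    by rewrite -lee_fin -bE -sT le_measure ?inE.
  have sb : (mu B = (\sum_(i < N.+1) b i)%:E)%E.
    rewrite -(cpi mB).2 -sumEFin.
    have -> : setT `*` B = \big[setU/set0]_(i < N.+1) (A i `*` B).
      rewrite -(bigcup_mkord N.+1 (fun i => A i `*` B)).
      apply/seteqP; split=> -[x y] /=; last by move=> [i iN [Ax By]].
      move=> [_ By]; have : setT x by [].
      by rewrite -cA -(bigcup_mkord N.+1 A) => -[i iN Ax]; exists i.
    rewrite (@measure_semi_additive _ _ _ pi (fun i => A i `*` B))//.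
    + by apply: eq_bigr => i _; rewrite -bE (hs i).1.
    + by move=> i; exact: measurableX.
    + apply/trivIsetP => i j _ _ ij; rewrite -subset0 => -[x y] [[/= ? ?] [/= ? ?]].
      by move/trivIsetP : tA => /(_ i j I I ij); rewrite -subset0 => /(_ x); apply.
    + by apply: bigsetU_measurable => i _; exact: measurableX.
  have key i : m' i * (alpha i / m' i * b i) = alpha i * b i.
    have [m'0|m'0] := eqVneq (m' i) 0; last by field.
    rewrite m'0 mul0r; apply/esym/eqP; rewrite eq_le mulr_ge0// andbT.
    by rewrite -m'0 (le_trans _ (alpha_m i))// ler_wpM2l.
  have -> : (\sum_(i < N.+1) nu' (A i) * k i B =
      (\sum_(i < N.+1) (alpha i * b i +
         (m' i * beta i) * ((e * \sum_(j < N.+1) b j + (1 - e) * b N) / theta)))%:E)%E.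
    rewrite -sumEFin; apply: eq_bigr => i _.
    rewrite (hk i).1 m'E sgE bE bE/= sb; do 3 rewrite -?EFinM -?EFinD.
    by congr (_%:E); rewrite mulrDr key; congr (_ + _); ring.
  rewrite sb; congr (_%:E); rewrite big_split/= -mulr_suml sum_beta sum_alpha.
  rewrite [in RHS]big_ord_recr/= [X in e * X]big_ord_recr/=.
  by field; rewrite gt_eqF.
- move=> i u mu_ u0; rewrite (hk i).2// sgI// (hs i).2//; congr (_ + _ * (_ + _ * _))%E.
  by rewrite (hs N).2.
Qed.

Variables (c : X -> X -> R) (psi : X -> R) (C L D M : R).
Hypothesis c_ge0 : forall x y, 0 <= c x y.
Hypothesis mc : measurable_fun setT (fun z => c z.1 z.2).
Hypothesis psi_ge0 : forall x, 0 <= psi x.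
Hypothesis mpsi : measurable_fun setT psi.
Hypothesis C_ge0 : 0 <= C.
Hypothesis L_ge0 : 0 <= L.
Hypothesis D_ge0 : 0 <= D.
Hypothesis M_ge0 : 0 <= M.
Hypothesis c_cell : forall i x x' y, (i < N)%N -> A i x -> A i x' ->
  c x y <= L * c x' y + D.
Hypothesis c_psi : forall x y, c x y <= psi x + C * psi y.
Hypothesis psi_cell : forall i x, (i < N)%N -> A i x -> psi x <= M.
Hypothesis c_int : (\int[pi]_z (c z.1 z.2)%:E < +oo)%E.
Hypothesis psi_int : (\int[mu]_y (psi y)%:E < +oo)%E.

Let mcE : measurable_fun setT (fun z : X * X => (c z.1 z.2)%:E).
Proof. exact/measurable_EFinP. Qed.
Let mpsiE : measurable_fun setT (fun x => (psi x)%:E).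
Proof. exact/measurable_EFinP. Qed.
Let mpsi2 : measurable_fun setT (fun z : X * X => (psi z.2)%:E).
Proof. by apply/measurable_EFinP; exact: measurableT_comp. Qed.
Let mAT i : measurable (A i `*` [set: X]). Proof. exact: measurableX. Qed.
Let cE_ge0 (z : X * X) : (0 <= (c z.1 z.2)%:E)%E. Proof. by rewrite lee_fin. Qed.
Let psiE_ge0 x : (0 <= (psi x)%:E)%E. Proof. by rewrite lee_fin. Qed.
Let mcx x : measurable_fun setT (fun y => (c x y)%:E).
Proof. by apply/measurable_EFinP; exact: (measurableT_comp mc (pair1_measurable x)). Qed.
Let mcx2 x : measurable_fun setT (fun z : X * X => (c x z.2)%:E).
Proof.
apply/measurable_EFinP.
exact: (measurableT_comp ((measurable_EFinP _ _).1 (mcx x)) measurable_snd).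
Qed.

Let Ic i := fine (\int[pi]_(z in A i `*` setT) (c z.1 z.2)%:E).
Let P := fine (\int[mu]_y (psi y)%:E).
Let Q := fine (\int[pi]_(z in A N `*` setT) (psi z.2)%:E).
Let I0 := fine (\int[pi]_z (c z.1 z.2)%:E).

Let I0E : (\int[pi]_z (c z.1 z.2)%:E = I0%:E)%E.
Proof. by rewrite fineK// ge0_fin_numE// integral_ge0. Qed.
Let PE : (\int[mu]_y (psi y)%:E = P%:E)%E.
Proof. by rewrite fineK// ge0_fin_numE// integral_ge0. Qed.
Let IcE i : (\int[pi]_(z in A i `*` setT) (c z.1 z.2)%:E = (Ic i)%:E)%E.
Proof.
rewrite fineK// ge0_fin_numE ?integral_ge0//; apply: le_lt_trans c_int.
by apply: ge0_subset_integral.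
Qed.
Let QE : (\int[pi]_(z in A N `*` setT) (psi z.2)%:E = Q%:E)%E.
Proof.
rewrite fineK// ge0_fin_numE ?integral_ge0//; apply: le_lt_trans psi_int.
rewrite -(coupling_integral_snd cpi mpsiE psiE_ge0).
exact: ge0_subset_integral.
Qed.
Let Ic_ge0 i : 0 <= Ic i. Proof. by rewrite fine_ge0// integral_ge0. Qed.
Let P_ge0 : 0 <= P. Proof. by rewrite fine_ge0// integral_ge0. Qed.
Let Q_ge0 : 0 <= Q. Proof. by rewrite fine_ge0// integral_ge0. Qed.

Let sum_Ic : \sum_(i < N) Ic i <= I0.
Proof.
have tAT : trivIset setT (fun i => A i `*` [set: X]).
  apply/trivIsetP => i j _ _ ij; rewrite -subset0 => -[x y] [[/= ? ?] [/= ? ?]].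
  by move/trivIsetP : tA => /(_ i j I I ij); rewrite -subset0 => /(_ x); apply.
have := @ge0_integral_bigsetU _ _ _ pi nat (fun i => A i `*` [set: X])
  (fun z => (c z.1 z.2)%:E) (index_iota 0 N) mAT (iota_uniq _ _).
move=> /(_ (sub_trivIset (@subsetT _ _) tAT)) /= h.
rewrite -lee_fin -I0E -sumEFin.
under eq_bigr do rewrite -IcE.
rewrite -(big_mkord xpredT (fun i => \int[pi]_(z in A i `*` setT) (c z.1 z.2)%:E)%E).
rewrite -h//; last by apply: measurable_funTS.
apply: ge0_subset_integral => //.
by apply: bigsetU_measurable.
Qed.

Let slice_cell i x : (i < N)%N -> A i x ->
  (\int[pi]_(z in A i `*` setT) (c x z.2)%:E <= (L * Ic i + D * m i)%:E)%E.
Proof.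
move=> iN Ax; rewrite EFinD 2!EFinM -IcE -mE -(cpi (mA i)).1.
rewrite -integral_cst// -ge0_integralZl//; last first.
  exact: measurable_funTS.
rewrite -ge0_integralD//; last 2 first.
- by move=> z _; rewrite mule_ge0// lee_fin.
- by apply: measurable_funeM; exact: measurable_funTS.
apply: ge0_le_integral => //.
- by move=> z _; rewrite lee_fin.
- exact: measurable_funTS.
- apply: emeasurable_funD => //; apply: measurable_funeM; exact: measurable_funTS.
- by move=> z [Az _]; rewrite -EFinM -EFinD lee_fin; apply: (c_cell _ iN).
Qed.

(** The coefficient of [psi x] is the mass [theta] of [sigma]. After the normalization by [theta],
    the rest [A N] thus pays [psi] with coefficient exactly 1. *)
Let slice_rest x :
  (e%:E * \int[mu]_y (c x y)%:E +
     (1 - e)%:E * \int[pi]_(z in A N `*` setT) (c x z.2)%:E <=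
   (theta * psi x + C * (e * P + (1 - e) * Q))%:E)%E.
Proof.
have h1 : (\int[mu]_y (c x y)%:E <= (psi x + C * P)%:E)%E.
  rewrite EFinD EFinM -PE -[X in (X + _)%E]mule1 -(@probability_setT _ _ _ mu).
  rewrite -integral_cst// -ge0_integralZl// -ge0_integralD//; last 3 first.
  - by move=> y _; exact: psiE_ge0.
  - by move=> y _; rewrite mule_ge0.
  - exact: measurable_funeM.
  apply: ge0_le_integral => //.
  - by move=> y _; rewrite lee_fin.
  - by apply: emeasurable_funD => //; exact: measurable_funeM.
  - by move=> y _; rewrite -EFinM -EFinD lee_fin.
have h2 : (\int[pi]_(z in A N `*` setT) (c x z.2)%:E <= (psi x * m N + C * Q)%:E)%E.
  rewrite EFinD 2!EFinM -QE -mE -(cpi (mA N)).1.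
  rewrite -integral_cst// -ge0_integralZl//; last exact: measurable_funTS.
  rewrite -ge0_integralD//; last 3 first.
  - by move=> z _; exact: psiE_ge0.
  - by move=> z _; rewrite mule_ge0.
  - by apply: measurable_funeM; exact: measurable_funTS.
  apply: ge0_le_integral => //.
  - by move=> z _; rewrite lee_fin.
  - exact: measurable_funTS.
  - apply: emeasurable_funD => //; apply: measurable_funeM; exact: measurable_funTS.
  - by move=> z _; rewrite -EFinM -EFinD lee_fin.
have -> : ((theta * psi x + C * (e * P + (1 - e) * Q))%:E =
   e%:E * (psi x + C * P)%:E + (1 - e)%:E * (psi x * m N + C * Q)%:E)%E.
  by rewrite -!EFinM -EFinD; congr (_%:E); rewrite /theta; ring.
by rewrite leeD// lee_wpmul2l// lee_fin ?subr_ge0 ltW.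
Qed.

(** The part kept within cells costs at most [L * I0 + D]. Of the leftover mass [theta], the rest
    [A N] takes [m' N]; what falls on the cells has mass [theta - m' N], at most [e + m N - m' N],
    and pays [psi <= M] per unit. The second marginal of the leftover contributes the terms with
    [C]. *)
Lemma transport_refine :
  (transport_cost c nu' mu <= L%:E * \int[pi]_z (c z.1 z.2)%:E + D%:E +
     M%:E * (e%:E + nu (A N) - nu' (A N)) + \int[nu']_(x in A N) (psi x)%:E +
     C%:E * (e%:E * \int[mu]_y (psi y)%:E +
       \int[pi]_(z in A N `*` setT) (psi z.2)%:E))%E.
Proof.
have [k [k1 kmu kI]] := glue_kernel.
apply: (le_trans (transport_le_mixture c_ge0 mc mA tA cA k1 kmu)).
set S := e * P + (1 - e) * Q.
have S_ge0 : 0 <= S by rewrite /S addr_ge0 ?mulr_ge0// ?subr_ge0 ltW.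
have mk i : measurable_fun setT (fun x => \int[k i]_y (c x y)%:E)%E.
  by apply: (measurable_fun_fubini_tonelli_F (fun z => (c z.1 z.2)%:E)).
have k_ge0 i x : (0 <= \int[k i]_y (c x y)%:E)%E.
  by apply: integral_ge0 => y _; rewrite lee_fin.
have bnd i : (i < N)%N ->
    (\int[nu']_(x in A i) \int[k i]_y (c x y)%:E <=
     ((1 - e) * (L * Ic i + D * m i) + m' i * beta i * (M + C * S / theta))%:E)%E.
  move=> iN.
  pose r := alpha i / m' i * (L * Ic i + D * m i) + beta i / theta * (theta * M + C * S).
  have rE : (r%:E = (alpha i / m' i)%:E * (L * Ic i + D * m i)%:E +
      (beta i / theta)%:E * (theta * M + C * S)%:E)%E by rewrite -!EFinM -EFinD.
  apply: (@le_trans _ _ (\int[nu']_(x in A i) (cst r%:E x))%E).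
    apply: ge0_le_integral => //.
    - exact: measurable_funTS.
    - move=> x Ax; rewrite kI//; last by move=> y; rewrite lee_fin.
      rewrite /cst rE leeD//.
        by rewrite lee_wpmul2l ?lee_fin ?divr_ge0//; exact: slice_cell.
      rewrite lee_wpmul2l ?lee_fin ?divr_ge0// ?(ltW theta_gt0)//.
      rewrite (le_trans (slice_rest _))// lee_fin lerD2r ler_pM2l//.
      exact: psi_cell iN Ax.
  rewrite integral_cst//= m'E -EFinM lee_fin /r mulrDl; apply: lerD.
    have [m'0|m'0] := eqVneq (m' i) 0.
      by rewrite m'0 mulr0 mulr_ge0 ?subr_ge0 ?(ltW e_lt1)// addr_ge0// mulr_ge0.
    by rewrite {1}/alpha iN; rewrite le_eqVlt; apply/predU1P; left; field.
  by rewrite le_eqVlt; apply/predU1P; left; field; rewrite gt_eqF.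
have bndN : (\int[nu']_(x in A N) \int[k N]_y (c x y)%:E <=
     \int[nu']_(x in A N) (psi x)%:E + (m' N * (C * S / theta))%:E)%E.
  rewrite mulrC EFinM -m'E -integral_cst// -ge0_integralD//; last 2 first.
  - exact: measurable_funTS.
  - by move=> x _; rewrite lee_fin !mulr_ge0// invr_ge0 ltW.
  apply: ge0_le_integral => //.
  - exact: measurable_funTS.
  - by apply: emeasurable_funD => //; exact: measurable_funTS.
  move=> x _; rewrite kI//; last by move=> y; rewrite lee_fin.
  rewrite /beta /alpha ltnn !mul0r mul0e add0e subr0.
  rewrite (@le_trans _ _ ((1 / theta)%:E * (theta * psi x + C * S)%:E)%E)//.
    by rewrite lee_wpmul2l// ?lee_fin ?divr_ge0// ?(ltW theta_gt0).
  rewrite -EFinM /= -EFinD lee_fin; rewrite le_eqVlt; apply/predU1P; left; field; exact: lt0r_neq0.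
rewrite big_ord_recr/=.
have hsum : (\sum_(i < N) \int[nu']_(x in A i) \int[k i]_y (c x y)%:E <=
    ((1 - e) * (L * (\sum_(i < N) Ic i) + D * (\sum_(i < N) m i)) +
     (\sum_(i < N) m' i * beta i) * (M + C * S / theta))%:E)%E.
  rewrite !mulr_sumr -big_split/= mulr_sumr mulr_suml -big_split/= -sumEFin.
  by apply: lee_sum => i _; apply: bnd.
apply: (le_trans (leeD hsum bndN)).
rewrite I0E PE QE mE m'E addeCA [leRHS](_ : _ =
  \int[nu']_(x in A N) (psi x)%:E + (L * I0 + D + M * (e + m N - m' N) +
    C * (e * P + Q))%:E)%E; last first.
  by rewrite -?EFinM -?EFinD -?EFinB -?EFinM -?EFinD -?EFinM -addeA addeCA -EFinD.
rewrite leeD2l// -EFinD lee_fin.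
have s1 : \sum_(i < N) m i = 1 - m N.
  by move: sum_m; rewrite big_ord_recr/= => /(canRL (addrK _)).
have s2 : \sum_(i < N) m' i * beta i = theta - m' N.
  move: sum_beta; rewrite big_ord_recr/= => /(canRL (addrK _)) ->.
  by rewrite beta_m' /alpha ltnn mul0r subr0.
rewrite s1 s2.
have t1 : (theta - m' N) * (M + C * S / theta) + m' N * (C * S / theta) =
    (theta - m' N) * M + C * S by field; exact: lt0r_neq0.
have l1 : (1 - e) * (L * (\sum_(i < N) Ic i) + D * (1 - m N)) <= L * I0 + D.
  have mN1 : 0 <= 1 - m N by rewrite -s1 sumr_ge0.
  have h1 : L * (\sum_(i < N) Ic i) + D * (1 - m N) <= L * I0 + D.
    by rewrite lerD ?ler_wpM2l// ler_piMr// gerBl.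
  rewrite (le_trans _ h1)// ler_piMl ?gerBl ?(ltW e_gt0)//.
  by rewrite addr_ge0// mulr_ge0// sumr_ge0.
have l2 : (theta - m' N) * M <= M * (e + m N - m' N).
  rewrite mulrC ler_wpM2l// lerD2r /theta lerD2l ler_piMl// gerBl ltW//.
have l3 : C * S <= C * (e * P + Q).
  by rewrite ler_wpM2l// /S lerD2l ler_piMl// gerBl ltW.
by move: t1 l1 l2 l3; rewrite -/S; lra.
Qed.

End gluing.

(** * Exponential moments from exponential tails *)

Section exponential_tail.
Context {d} {X : measurableType d} {R : realType}.
Variables (mu : probability X R) (Y : X -> R) (D kappa lambda : R).

(** Slicing by the integer part of [Y] bounds the exponential by a series whose terms integrate to
    at most [K * q ^+ n], with ratio [q = expR (lambda - kappa)] below 1. *)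
Lemma exp_integrable_of_tail : measurable_fun setT Y -> (forall x, 0 <= Y x) ->
  0 <= lambda -> lambda < kappa ->
  (forall t, (mu [set x | (t < Y x)%R] <= (D * expR (- (kappa * t)))%:E)%E) ->
  (\int[mu]_x (expR (lambda * Y x))%:E < +oo)%E.
Proof.
move=> mY Y0 l0 lk htail.
(* The tail bound is for strict inequalities, hence the threshold [n%:R - 1]: it lies strictly below
   [Y x] when [n] is the integer part of [Y x]. *)
pose S (n : nat) := [set x | n%:R - 1 < Y x].
have mS n : measurable (S n).
  rewrite (_ : S n = Y @^-1` `]n%:R - 1, +oo[); last first.
    by apply/seteqP; split => x; rewrite /S/= in_itv/= andbT.
  by rewrite -[X in measurable X]setTI; exact: mY.
pose g (n : nat) x : \bar R := ((expR (lambda * n.+1%:R))%:E * (\1_(S n) x)%:E)%E.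
have g0 n x : (0 <= g n x)%E by rewrite mule_ge0// lee_fin.
have mg n : measurable_fun setT (g n).
  by apply: measurable_funeM; apply/measurable_EFinP; exact: measurable_indic.
apply: (@le_lt_trans _ _ (\int[mu]_x (\sum_(0 <= n <oo) g n x))%E).
  apply: ge0_le_integral => //.
  - apply/measurable_EFinP; apply: measurableT_comp; first exact: measurable_expR.
    exact: measurable_funM.
  - by apply: ge0_emeasurable_sum => // n x _ _; exact: g0.
  move=> x _; pose n := Num.Def.trunc (Y x).
  have /andP[nY Yn] : n%:R <= Y x < n.+1%:R by exact: truncn_itv.
  apply: (@le_trans _ _ (g n x)).
    rewrite /g indicE mem_set/= ?mule1; last by rewrite /S/=; lra.
    by rewrite lee_fin ler_expR ler_wpM2l// ltW.
  apply: le_trans (nneseries_lim_ge n.+1 _) => //.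
  by rewrite big_nat_recr//= leeDr// sume_ge0.
rewrite integral_nneseries//.
pose q := expR (lambda - kappa).
have q1 : q < 1 by rewrite /q -[ltRHS]expR0 ltr_expR subr_lt0.
have q0 : 0 <= q by exact: expR_ge0.
pose K := expR lambda * (D * expR kappa).
have K0 : 0 <= K.
  rewrite mulr_ge0 ?expR_ge0//.
  have := htail (-1); rewrite mulrN1 opprK => /(le_trans _); rewrite -lee_fin.
  by apply; exact: measure_ge0.
have gn n : (\int[mu]_x g n x <= (K * q ^+ n)%:E)%E.
  rewrite /g ge0_integralZl//; last by apply/measurable_EFinP; exact: measurable_indic.
  rewrite integral_indic// setIT.
  apply: (le_trans (lee_wpmul2l _ (htail _))); first by rewrite lee_fin expR_ge0.
  rewrite -EFinM lee_fin le_eqVlt; apply/predU1P; left.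
  rewrite /K /q -expRM_natr !mulrA [LHS]mulrC [RHS]mulrC.
  rewrite -[in LHS]natr1.
  rewrite [LHS](_ : _ = D *
    (expR (- (kappa * (n%:R - 1))) * expR (lambda * (n%:R + 1)))); last by ring.
  rewrite [RHS](_ : _ = D *
    (expR lambda * expR kappa * expR ((lambda - kappa) * n%:R))); last by ring.
  by rewrite -!expRD; congr (_ * expR _); ring.
have geo n : \sum_(0 <= i < n) q ^+ i <= (1 - q)^-1.
  rewrite -[leRHS]mul1r ler_pdivlMr ?subr_gt0//.
  have -> : (\sum_(0 <= i < n) q ^+ i) * (1 - q) = 1 - q ^+ n.
    elim: n => [|n ih]; first by rewrite big_geq// mul0r expr0 subrr.
    by rewrite big_nat_recr//= mulrDl ih exprS; ring.
  by rewrite gerBl exprn_ge0.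
apply: (@le_lt_trans _ _ (K / (1 - q))%:E); last exact: ltry.
apply: lime_le.
  by apply: is_cvg_nneseries => n _ _; apply: integral_ge0 => x _; exact: g0.
apply: nearW => n; apply: (@le_trans _ _ (\sum_(0 <= i < n) (K * q ^+ i)%:E)%E).
  by apply: lee_sum => i _; exact: gn.
by rewrite sumEFin -mulr_sumr lee_fin ler_wpM2l.
Qed.

End exponential_tail.

(** * Measurability of the distance and of the cost *)

Section metric_measurability.
Context {d} {X : measurableType d} {R : realType} (dist : X -> X -> R).
Hypothesis Xpolish : polish dist.
Hypothesis Xborel : borel_for dist.

Let dist_ge0 x y : 0 <= dist x y. Proof. by case: Xpolish => -[+ _ _ _] _ _; exact. Qed.
Let dist_sym x y : dist x y = dist y x. Proof. by case: Xpolish => -[_ _ + _] _ _; exact. Qed.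
Let dist_tri x y z : dist x z <= dist x y + dist y z.
Proof. by case: Xpolish => -[_ _ _ +] _ _; exact. Qed.

Lemma polish_dense_seq : exists q : nat -> X,
  forall x (e : R), 0 < e -> exists i, dist x (q i) < e.
Proof.
case: Xpolish => _ _ [D [/countable_injP[f finj] Ddense]].
pose q (n : nat) : X := if pselect (exists y, D y /\ f y = n) is left h
  then projT1 (cid h) else point.
exists q => x e e0; have [y Dy xy] := Ddense x e e0; exists (f y).
rewrite /q; case: pselect => [h|]; last by move=> /(_ (ex_intro _ y (conj Dy erefl))).
case: (cid h) => z [Dz /= fzy].
by rewrite (finj z y)// inE.
Qed.

Lemma measurable_dist_ball x (r : R) : measurable [set y | dist x y < r].
Proof.
rewrite Xborel; apply: sub_sigma_algebra => y /= xy.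
exists (r - dist x y); first by rewrite subr_gt0.
by move=> z /=; have := dist_tri x y z; lra.
Qed.

(** Measurability is for the product sigma-algebra, so separability is used: an open sublevel set is
    a countable union of products of balls around a dense sequence. *)
Lemma measurable_dist : measurable_fun setT (fun z : X * X => dist z.1 z.2).
Proof.
have [q qd] := polish_dense_seq.
apply: (measurability _ (@RGenCInfty.measurableE R)) => _ [_ [r ->] <-].
rewrite setTI (_ : _ @^-1` _ = ~` [set z : X * X | dist z.1 z.2 < r]); last first.
  by apply/seteqP; split => z /=; rewrite in_itv/= andbT leNgt => /negP.
apply: measurableC.
rewrite (_ : [set z : X * X | _] = \bigcup_n \bigcup_i
    ([set y | dist (q i) y < n.+1%:R^-1] `*` [set y | dist (q i) y < r - n.+1%:R^-1])).
  apply: bigcup_measurable => n _; apply: bigcup_measurable => i _.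
  by apply: measurableX; exact: measurable_dist_ball.
apply/seteqP; split => [[x y] /= xy|[x y] [n _ [i _ [/= h1 h2]]]]; last first.
  move: (n.+1%:R^-1) h1 h2 => s h1 h2; apply: (le_lt_trans (dist_tri x (q i) y)).
  by rewrite (dist_sym x (q i)); lra.
(* The radius is below half the gap [r - dist x y]: moving from [x] to a close [q i] uses one half,
   and the other half is the margin of the second ball. *)
pose n := Num.Def.trunc ((r - dist x y) / 2)^-1.
have e0 : 0 < (r - dist x y) / 2 by rewrite divr_gt0// subr_gt0.
have hn : n.+1%:R^-1 < (r - dist x y) / 2.
  by rewrite invf_plt ?posrE// truncnS_gt.
have [i xi] := qd x n.+1%:R^-1 ltac:(by rewrite invr_gt0).
exists n => //; exists i => //; split => /=; first by rewrite dist_sym.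
move: (n.+1%:R^-1) hn xi => s hn xi; apply: (le_lt_trans (dist_tri (q i) x y)).
by rewrite (dist_sym (q i) x); lra.
Qed.

Lemma measurable_cells (e : R) : 0 < e -> exists (q : nat -> X) (B : nat -> set X),
  [/\ forall i, measurable (B i), trivIset setT B, \bigcup_i B i = setT &
      forall i x, B i x -> dist (q i) x < e].
Proof.
move=> e0; have [q qd] := polish_dense_seq.
pose F i := [set x | dist (q i) x < e].
exists q, (seqDU F); split.
- move=> i; apply: measurableD; first exact: measurable_dist_ball.
  by apply: bigsetU_measurable => j _; exact: measurable_dist_ball.
- exact: trivIset_seqDU.
- rewrite -seqDU_bigcup_eq; apply/seteqP; split => // x _.
  by have [i xi] := qd x e e0; exists i => //; rewrite /F/= dist_sym.
- by move=> i x [].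
Qed.

Variable phi : R -> R.
Hypothesis phiP : power_type phi.

Lemma measurable_cost : measurable_fun setT (fun z : X * X => phi (dist z.1 z.2)).
Proof.
(* Nothing is known about [phi] on negative numbers; truncating the argument at 0 gives a function
   monotone on the whole line. *)
pose phi0 x := phi (Num.max 0 x).
have -> : (fun z : X * X => phi (dist z.1 z.2)) = phi0 \o (fun z => dist z.1 z.2).
  by apply/funext => z; rewrite /phi0/= max_r.
apply: measurableT_comp; last exact: measurable_dist.
apply: nondecreasing_measurable => // x y xy.
apply: (power_type_nondecreasing phiP); first by rewrite le_max lexx.
by rewrite ge_max !le_max lexx xy orbT.
Qed.

End metric_measurability.

(** * From concentration to exponential integrability of the cost *)

Section concentration.
Context {d} {X : measurableType d} {R : realType} (dist : X -> X -> R).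
Variables (mu : probability X R) (phi : R -> R) (a' r_o : R).
Hypothesis Xpolish : polish dist.
Hypothesis Xborel : borel_for dist.
Hypothesis phiP : power_type phi.
Hypothesis a'_gt0 : 0 < a'.
Hypothesis r_o_ge0 : 0 <= r_o.
(** The enlargement is a projection and may fail to be measurable, hence the bound on its measurable
    supersets. *)
Hypothesis conc : forall A : set X, measurable A -> ((2^-1)%:E <= mu A)%E ->
  forall r : R, r_o <= r ->
  forall B : set X, measurable B -> enlargement (dtilde dist phi) A r `<=` B ->
  ((1 - expR (- ((r - r_o) `^ cost_exponent phi) / a'))%:E <= mu B)%E.

Local Notation p := (cost_exponent phi).

Let dist_ge0 x y : 0 <= dist x y. Proof. by case: Xpolish => -[+ _ _ _] _ _; exact. Qed.
Let dist_tri x y z : dist x z <= dist x y + dist y z.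
Proof. by case: Xpolish => -[_ _ _ +] _ _; exact. Qed.
Let phi_ge0 x : 0 <= x -> 0 <= phi x. Proof. by case: phiP => + _ _ _ _; exact. Qed.
Let p_gt0 : 0 < p. Proof. by rewrite (lt_le_trans _ (cost_exponent_ge1 phiP)). Qed.

Variable x0 : X.
Let Y x := phi (dist x x0).

Let Y_ge0 x : 0 <= Y x. Proof. exact: phi_ge0. Qed.

Let mY : measurable_fun setT Y.
Proof.
exact: (measurableT_comp (measurable_cost Xpolish Xborel phiP) (pair2_measurable x0)).
Qed.

Let mYle t : measurable [set x | Y x <= t].
Proof.
rewrite (_ : [set x | Y x <= t] = Y @^-1` `]-oo, t]).
  by rewrite -[X in measurable X]setTI; exact: mY.
by apply/seteqP; split => x; rewrite /= in_itv.
Qed.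

Let median : exists L : R, ((2^-1)%:E <= mu [set x | (Y x <= L)%R])%E /\ 0 <= L.
Proof.
have := @nondecreasing_cvg_mu _ _ _ mu (fun n : nat => [set x | Y x <= n%:R])
  (fun n => mYle _).
have -> : \bigcup_n [set x | Y x <= n%:R] = setT.
  apply/seteqP; split => // x _; exists (Num.Def.trunc (Y x)).+1 => //=.
  by rewrite ltW// truncnS_gt.
move=> /(_ measurableT).
have nd : {homo (fun n : nat => [set x | Y x <= n%:R]) : n m / (n <= m)%N >-> (n <= m)%O}.
  by move=> n m nm; apply/subsetPset => x /= /le_trans; apply; rewrite ler_nat.
move=> /(_ nd); rewrite /= probability_setT => cv.
apply: contrapT => h; have : (1 <= (2^-1)%:E :> \bar R)%E.
  apply: (cvge_to_le cv); apply: nearW => n; rewrite leNgt; apply/negP => hn.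
  by apply: h; exists n%:R; split => //; exact: ltW.
by rewrite lee_fin; lra.
Qed.

Let enlargement_sub (eta C L r : R) : 0 <= C -> 0 <= eta ->
  (forall u v, 0 <= u -> 0 <= v -> phi (u + v) <= (1 + eta) * phi u + C * phi v) ->
  0 <= r ->
  enlargement (dtilde dist phi) [set x | Y x <= L] r `<=`
  [set x | Y x <= (1 + eta) * r `^ p + C * L].
Proof.
move=> C0 eta0 tri r0 x [y /= yL]; rewrite /dtilde => xyr.
have phixy : phi (dist x y) <= r `^ p.
  have := ge0_ler_powR (ltW p_gt0) _ _ xyr.
  rewrite -powRrM mulVf ?gt_eqF// powRr1; last exact: phi_ge0.
  by apply; rewrite nnegrE ?powR_ge0.
have : Y x <= phi (dist x y + dist y x0).
  by apply: (power_type_nondecreasing phiP).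
move=> /le_trans; apply.
apply: (le_trans (tri _ _ (dist_ge0 _ _) (dist_ge0 _ _))).
by rewrite lerD// ler_wpM2l// addr_ge0.
Qed.

Let tail (eta C L : R) : 0 <= C -> 0 < eta -> eta < 1 -> 0 <= L ->
  ((2^-1)%:E <= mu [set x | (Y x <= L)%R])%E ->
  (forall u v, 0 <= u -> 0 <= v -> phi (u + v) <= (1 + eta) * phi u + C * phi v) ->
  exists2 s0, 0 <= s0 & forall s, s0 <= s ->
    (mu [set x | ((1 + eta) * s + C * L < Y x)%R] <=
      (expR (- ((1 - eta) * s) / a'))%:E)%E.
Proof.
move=> C0 eta0 eta1 L0 hL tri.
pose w := (1 - eta) `^ p^-1.
have w0 : 0 <= w by exact: powR_ge0.
have w1 : w < 1.
  rewrite ltNge; apply/negP => h.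
  have := ge0_ler_powR (ltW p_gt0) _ _ h.
  rewrite /w -powRrM mulVf ?gt_eqF// powRr1 ?subr_ge0 ?(ltW eta1)// powR1.
  rewrite !nnegrE ler01 powR_ge0 => /(_ erefl erefl); lra.
exists ((r_o / (1 - w)) `^ p); first exact: powR_ge0.
move=> s hs; have s0 : 0 <= s by apply: le_trans hs; exact: powR_ge0.
pose r := s `^ p^-1.
have r0 : 0 <= r by exact: powR_ge0.
have rp : r `^ p = s by rewrite /r -powRrM mulVf ?gt_eqF// powRr1.
have rge : r_o / (1 - w) <= r.
  have pV0 : 0 <= p^-1 by rewrite invr_ge0 ltW.
  have := ge0_ler_powR pV0 _ _ hs.
  rewrite -powRrM mulfV ?gt_eqF// powRr1; last by rewrite divr_ge0// subr_ge0 ltW.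
  by apply; rewrite nnegrE// powR_ge0.
have rw : w * r <= r - r_o.
  by move: rge; rewrite ler_pdivrMr ?subr_gt0//; lra.
have ror : r_o <= r.
  by rewrite -subr_ge0 (le_trans _ rw)// mulr_ge0.
have hB := conc (mYle L) hL ror (mYle ((1 + eta) * s + C * L)).
have {}hB := hB _.
have hmu : ((1 - expR (- ((r - r_o) `^ p) / a'))%:E <=
    mu [set x | (Y x <= (1 + eta) * s + C * L)%R])%E.
  by apply: hB; rewrite -rp; apply: enlargement_sub => //; exact: ltW.
have -> : [set x | (1 + eta) * s + C * L < Y x] =
    ~` [set x | Y x <= (1 + eta) * s + C * L].
  by apply/seteqP; split => x /=; rewrite ltNge => /negP.
rewrite probability_setC//.
apply: (@le_trans _ _ (1 - (1 - expR (- ((r - r_o) `^ p) / a'))%:E)%E).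
  by rewrite leeB.
rewrite -EFinB lee_fin opprB addrC subrK ler_expR ler_pM2r ?invr_gt0// lerN2.
have -> : (1 - eta) * s = (w * r) `^ p.
  by rewrite powRM// rp /w -powRrM mulVf ?gt_eqF// powRr1// subr_ge0 ltW.
by apply: (ge0_ler_powR (ltW p_gt0)) => //; rewrite nnegrE ?mulr_ge0// subr_ge0.
Qed.

(** In the variable [t = (1 + eta) * s + C * L] the tail decays at rate
    [kappa = (1 - eta) / ((1 + eta) * a')]; [eta] must be small enough for [(1 + eta) / b] to stay
    below it. *)
Lemma concentration_exp_integrable (b : R) : a' < b ->
  exists2 eta, 0 < eta &
    (\int[mu]_x (expR ((1 + eta) / b * phi (dist x x0)))%:E < +oo)%E.
Proof.
move=> ab; have b0 : 0 < b by exact: lt_trans ab.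
(* chosen so that [(1 + eta)^2 a' <= (1 + 3 eta) a' < (1 - eta) b] *)
pose eta := (b - a') / (2 * (3 * a' + b)).
have den0 : 0 < 2 * (3 * a' + b) by rewrite mulr_gt0// addr_gt0// mulr_gt0.
have eta0 : 0 < eta by rewrite divr_gt0// subr_gt0.
have eta1 : eta < 1 by rewrite ltr_pdivrMr//; move: a'_gt0 b0; lra.
have etaE : eta * (2 * (3 * a' + b)) = b - a' by rewrite divfK// gt_eqF.
exists eta => //.
have [C C0 tri] := power_type_weak_triangle phiP eta0.
have [L [hL L0]] := median.
have [s0 s00 hs] := tail C0 eta0 eta1 L0 hL tri.
pose kappa := (1 - eta) / ((1 + eta) * a').
have e1 : 0 < 1 + eta by lra.
have k0 : 0 < kappa by rewrite divr_gt0 ?mulr_gt0// subr_gt0.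
pose T := (1 + eta) * s0 + C * L.
(* The first term serves [t >= T], where [tail] applies; the second makes the bound at least 1,
   hence trivial, for [t < T]. *)
pose D := expR (kappa * (C * L)) + expR (kappa * T).
apply: (@exp_integrable_of_tail _ _ _ mu Y D kappa) => //.
- exact: divr_ge0 (ltW e1) (ltW b0).
- rewrite /kappa ltr_pdivrMr// mulrAC ltr_pdivlMr ?mulr_gt0//.
  have : eta * eta <= eta by exact: ler_piMl (ltW eta0) (ltW eta1).
  move: etaE => h h2.
  have h3 : eta * eta * a' <= eta * a' by rewrite ler_pM2r.
  move: ab h h3; lra.
move=> t; have [tT|Tt] := ltP t T.
  apply: (@le_trans _ _ 1%E).
    apply: probability_le1; rewrite (_ : [set x | t < Y x] = ~` [set x | Y x <= t]).
      exact: measurableC.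
    by apply/seteqP; split => x /=; rewrite ltNge => /negP.
  rewrite lee_fin (@le_trans _ _ (expR (kappa * T) * expR (- (kappa * t))))//.
    rewrite -expRD -[leLHS]expR0 ler_expR -mulrBr mulr_ge0 ?(ltW k0)//.
    by rewrite subr_ge0 ltW.
  by rewrite ler_pM2r ?expR_gt0// lerDr expR_ge0.
pose s := (t - C * L) / (1 + eta).
have ss : s0 <= s by rewrite ler_pdivlMr//; move: Tt; rewrite /T; lra.
have := hs _ ss.
have -> : (1 + eta) * s + C * L = t by rewrite /s; field; exact: lt0r_neq0.
move=> /le_trans; apply; rewrite lee_fin.
rewrite (@le_trans _ _ (expR (kappa * (C * L)) * expR (- (kappa * t))))//; last first.
  by rewrite ler_pM2r ?expR_gt0// lerDl expR_ge0.
rewrite -expRD ler_expR le_eqVlt; apply/predU1P; left.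
by rewrite /kappa /s; field; rewrite !gt_eqF.
Qed.

End concentration.

(** * Setwise limits of probabilities with bounded entropy *)

Section measure_of_dominated_content.
Context {d} {X : measurableType d} {R : realType}.
Variables (mu : probability X R) (L : set X -> R).
Hypothesis L_ge0 : forall A, 0 <= L A.
Hypothesis L_setT : L setT = 1.
Hypothesis L_add : forall A B, measurable A -> measurable B -> A `&` B = set0 ->
  L (A `|` B) = L A + L B.
Hypothesis L_ac : forall e, 0 < e -> exists2 r, 0 < r &
  forall A, measurable A -> fine (mu A) <= r -> L A <= e.

Let nuL A : \bar R := (L A)%:E.

Let L0 : L set0 = 0.
Proof.
have := L_add measurable0 measurable0 (setI0 _).
by rewrite setU0 => /eqP; rewrite -subr_eq subrr => /eqP.
Qed.

Let L_sum (F : nat -> set X) n : (forall i, measurable (F i)) -> trivIset setT F ->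
  L (\big[setU/set0]_(i < n) F i) = \sum_(0 <= i < n) L (F i).
Proof.
move=> mF tF; elim: n => [|n ih]; first by rewrite big_ord0 big_geq.
rewrite big_ord_recr big_nat_recr//= L_add ?ih//.
- by apply: bigsetU_measurable.
- rewrite -bigcup_mkord setI_bigcupl bigcup0// => i /= ni.
  by move/trivIsetP : tF; apply => //; rewrite ltn_eqF.
Qed.

Let mu_sum (F : nat -> set X) n : (forall i, measurable (F i)) -> trivIset setT F ->
  (mu (\big[setU/set0]_(i < n) F i) = \sum_(0 <= i < n) mu (F i))%E.
Proof.
move=> mF tF; rewrite big_mkord measure_semi_additive//.
exact: bigsetU_measurable.
Qed.

Let nuL0 : nuL set0 = 0%E. Proof. by rewrite /nuL L0. Qed.
Let nuL_ge0 A : (0 <= nuL A)%E. Proof. by rewrite lee_fin. Qed.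

(** By finite additivity the error after [n] sets is [L] of the remaining union. Its [mu]-mass tends
    to 0, so [L_ac] makes it small. *)
Let nuL_sigma_additive : semi_sigma_additive nuL.
Proof.
move=> F mF tF mUF; rewrite /nuL.
under eq_fun do rewrite sumEFin.
apply: cvg_EFin; first by apply: nearW.
apply/cvgrPdist_le => /= e e0.
have [r r0 hr] := L_ac e0.
pose G n := \big[setU/set0]_(i < n) F i.
have mG n : measurable (G n) by apply: bigsetU_measurable.
have GU n : G n `<=` \bigcup_i F i by rewrite /G -bigcup_mkord => x [i _ Fx]; exists i.
have mucv : (mu (G n) @[n --> \oo] --> mu (\bigcup_i F i))%E.
  under eq_fun do rewrite /G mu_sum//.
  exact: measure_semi_sigma_additive.
have mucv2 : fine (mu (G n)) @[n --> \oo] --> fine (mu (\bigcup_i F i)).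
  by apply: fine_cvg; rewrite fineK// fin_num_measure.
move/cvgrPdist_le : mucv2 => /(_ _ r0); apply: filterS => n hn.
have UE : \bigcup_i F i = G n `|` (\bigcup_i F i `\` G n) by rewrite setDUK.
have mD : measurable (\bigcup_i F i `\` G n) by exact: measurableD.
have LE : L (\bigcup_i F i) = L (G n) + L (\bigcup_i F i `\` G n).
  by rewrite {1}UE L_add// setDIK.
have -> : \sum_(0 <= i < n) L (F i) = L (G n) by rewrite -L_sum.
rewrite LE addrAC subrr add0r ger0_norm//; apply: hr => //.
have muE : (mu (\bigcup_i F i) = mu (G n) + mu (\bigcup_i F i `\` G n))%E.
  by rewrite {1}UE measureU// setDIK.
move: hn; rewrite muE fineD ?fin_num_measure// addrAC subrr add0r ger0_norm//.
exact: fine_ge0.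
Qed.

HB.instance Definition _ := isMeasure.Build _ _ _ nuL nuL0 nuL_ge0 nuL_sigma_additive.

Lemma probability_of_content : exists nu : probability X R, forall A, nu A = (L A)%:E.
Proof.
have [nu nuE] : exists nu : probability X R, nu = nuL :> (set X -> \bar R).
  by apply: probabilityP; rewrite /= /nuL L_setT.
by exists nu => A; rewrite nuE.
Qed.

End measure_of_dominated_content.

(** By compactness of the segment the image filter has a cluster point, and an ultrafilter converges
    to each of its cluster points. *)
Lemma ultrafilter_cvg (R : realType) (I : Type) (U : set_system I) (u : I -> R) (a b : R) :
  UltraFilter U -> (forall i, a <= u i <= b) -> cvg (u i @[i --> U]).
Proof.
move=> UU hu.
have UP : ProperFilter (u i @[i --> U]) by exact: fmap_proper_filter.
have [p [_ clp]] : `[a, b] `&` cluster (u i @[i --> U]) !=set0.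
  apply: (@segment_compact R a b) => //.
  by apply: nearW => i /=; rewrite in_itv/=; exact: hu.
apply/cvg_ex; exists p => A /= Ap.
have [//|hC] := in_ultra_setVsetC (u @^-1` A) UU.
by have [x []] := clp (~` A) A hC Ap.
Qed.

Section setwise_limit.
Context {d} {X : measurableType d} {R : realType}.
Variables (mu : probability X R) (I : Type) (U : set_system I).
Variables (nu_ : I -> probability X R) (M : R).
Hypothesis UU : UltraFilter U.
Hypothesis entM : forall i, (relative_entropy mu (nu_ i) <= M%:E)%E.

(** The absolute value changes nothing on measurable sets; it secures nonnegativity on the other
    sets, where the limit may not exist and [lim] is arbitrary. *)
Let L A : R := `|lim (fine (nu_ i A) @[i --> U])|.

Let fine_bounds A i : measurable A -> 0 <= fine (nu_ i A) <= 1.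
Proof.
by move=> mA; rewrite fine_ge0//= -lee_fin fineK ?fin_num_measure// probability_le1.
Qed.

Let cvgL A : measurable A -> fine (nu_ i A) @[i --> U] --> L A.
Proof.
move=> mA; have cv : cvg (fine (nu_ i A) @[i --> U]).
  by apply: (@ultrafilter_cvg _ _ _ _ 0 1) => i; exact: fine_bounds.
rewrite /L ger0_norm//; apply: limr_ge => //; apply: nearW => i.
by have /andP[] := fine_bounds i mA.
Qed.

Let L_bound K A : 0 < K -> measurable A ->
  L A <= M / K + expR K / K * fine (mu A).
Proof.
move=> K0 mA; apply: (cvgr_to_le (cvgL mA)); apply: nearW => i.
have H : (relative_entropy mu (nu_ i) < +oo)%E by rewrite (le_lt_trans (entM i))// ltry.
have := entropy_equiintegrable (ltW K0) mA H.
move=> /le_trans -/(_ _ (leeD2r _ (entM i))).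
rewrite -[in X in (X <= _)%E](fineK (fin_num_measure (nu_ i) _ mA)).
rewrite -[in X in (_ <= X)%E](fineK (fin_num_measure mu _ mA)).
rewrite -!EFinM -EFinD lee_fin => h.
rewrite -(ler_pM2l K0) (le_trans h)// le_eqVlt; apply/predU1P; left.
by field; exact: lt0r_neq0.
Qed.

Lemma entropy_bounded_setwise_limit : exists nu : probability X R,
  nu `<< mu /\
  forall A, measurable A -> fine (nu_ i A) @[i --> U] --> fine (nu A).
Proof.
have [nu nuE] : exists nu : probability X R, forall A, nu A = (L A)%:E.
  apply: (@probability_of_content _ _ _ mu).
  - by move=> A; exact: normr_ge0.
  - have := cvgL measurableT; under eq_fun do rewrite probability_setT/=.
    by move=> /(cvg_unique _)/(_ (cvg_cst _)) ->.
  - move=> A B mA mB AB; have := cvgL (measurableU _ _ mA mB).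
    under eq_fun => i do rewrite measureU// fineD ?fin_num_measure//.
    by move=> /(cvg_unique _)/(_ (cvgD (cvgL mA) (cvgL mB))) ->.
  (* This [K] makes [M / K] at most [e / 2]; the radius below then makes the term in [mu A] at most
     [e / 2]. *)
  - move=> e e0; pose K := 2 * (`|M| + 1) / e.
    have K0 : 0 < K by rewrite divr_gt0// mulr_gt0// ltr_wpDl.
    exists (e / 2 * K / expR K).
      by rewrite divr_gt0 ?expR_gt0// mulr_gt0// divr_gt0.
    move=> A mA hA; apply: (le_trans (L_bound K0 mA)).
    have -> : e = e / 2 + e / 2 by rewrite -splitr.
    apply: lerD.
      rewrite ler_pdivrMr// /K (_ : e / 2 * _ = `|M| + 1); last first.
        by field; exact: lt0r_neq0.
      by rewrite (le_trans (ler_norm _))// lerDl.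
    by rewrite mulrC -ler_pdivlMr ?divr_gt0 ?expR_gt0// invf_div mulrA.
exists nu; split; last by move=> A mA; rewrite nuE; exact: cvgL.
apply/null_content_dominatesP => A mA muA0; rewrite nuE; congr (_%:E).
apply/eqP; rewrite eq_le normr_ge0 andbT; apply/ler_addgt0Pr => e e0.
pose K := (`|M| + 1) / e.
have K0 : 0 < K by rewrite divr_gt0// ltr_wpDl.
rewrite add0r (le_trans (L_bound K0 mA))// muA0 mulr0 addr0 ler_pdivrMr//.
by rewrite /K mulrC divfK ?gt_eqF// (le_trans (ler_norm _))// lerDl.
Qed.

End setwise_limit.

(** * Tails of integrals and their cost in entropy *)

Section integral_tails.
Context {d} {X : measurableType d} {R : realType}.
Local Open Scope ereal_scope.

Lemma integral_exhaust_tail (m : {measure set X -> \bar R}) (F : nat -> set X)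
    (u : X -> \bar R) (e : R) :
  {homo F : i j / (i <= j)%N >-> i `<=` j} -> (forall i, measurable (F i)) ->
  \bigcup_i F i = setT -> measurable_fun setT u -> (forall x, 0 <= u x) ->
  \int[m]_x u x < +oo -> (0 < e)%R ->
  \forall n \near \oo, \int[m]_(x in ~` F n) u x <= e%:E.
Proof.
move=> ndF mF UF mu_ u0 uoo e0.
have ndF' : nondecreasing_seq F by move=> i j ij; apply/subsetPset; exact: ndF.
have := @ge0_nondecreasing_set_cvg_integral _ _ _ F u m ndF' mF
  (fun i => measurable_funTS mu_) (fun i x _ => u0 x).
rewrite UF => cv.
have split n : \int[m]_x u x = \int[m]_(x in F n) u x + \int[m]_(x in ~` F n) u x.
  rewrite -ge0_integral_setU ?setUv//; first exact: measurableC.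
  by apply/disj_setPS => x [].
have fin n : \int[m]_(x in F n) u x \is a fin_num.
  rewrite ge0_fin_numE ?integral_ge0//; apply: le_lt_trans uoo.
  exact: ge0_subset_integral.
have fint : \int[m]_x u x \is a fin_num by rewrite ge0_fin_numE// integral_ge0.
have cvr : fine (\int[m]_(x in F n) u x) @[n --> \oo] --> fine (\int[m]_x u x).
  by apply: fine_cvg; rewrite fineK.
move/cvgrPdist_le : cvr => /(_ _ e0); apply: filterS => n hn.
have fin2 : \int[m]_(x in ~` F n) u x \is a fin_num.
  rewrite ge0_fin_numE ?integral_ge0//; apply: le_lt_trans uoo.
  by apply: ge0_subset_integral => //; exact: measurableC.
rewrite -(fineK fin2) lee_fin; apply: le_trans hn.
have -> : fine (\int[m]_x u x) =
    (fine (\int[m]_(x in F n) u x) + fine (\int[m]_(x in ~` F n) u x))%R.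
  by rewrite {1}(split n) fineD.
by rewrite addrAC subrr add0r ler_norm.
Qed.

(** Young's inequality for [g] plus [psi / a] on [A]; since [g <= k], the extra exponential term is
    [expR k] times an integral over [A], small if [A] is chosen after [k]. Multiplied by [a], the
    left side contains the integral of [psi] over [A] with coefficient 1, the loss in
    [transport_refine]. *)
Lemma entropy_young_restricted (mu nu : probability X R) (g psi : X -> R)
    (A : set X) (k a : R) :
  relative_entropy mu nu < +oo -> measurable_fun setT g ->
  (forall x, (`|g x| <= k)%R) -> measurable_fun setT psi ->
  (forall x, (0 <= psi x)%R) -> measurable A -> (0 < a)%R ->
  \int[mu]_x (expR (psi x / a))%:E < +oo ->
  \int[nu]_x (g x)%:E + (a^-1)%:E * \int[nu]_(x in A) (psi x)%:E + 1 <=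
  relative_entropy mu nu + (\int[mu]_x (expR (g x))%:E +
    (expR k)%:E * \int[mu]_(x in A) (expR (psi x / a))%:E).
Proof.
move=> H mg gk mpsi psi0 mA a0 psioo.
have k0 (x : X) : (0 <= k)%R by exact: le_trans (normr_ge0 _) (gk x).
pose w x : R := (psi x / a * \1_A x)%R.
have w0 x : (0 <= w x)%R by rewrite mulr_ge0// divr_ge0// ltW.
have mw : measurable_fun setT w.
  apply: measurable_funM; last exact: measurable_indic.
  exact: measurable_funM.
pose h x := (g x + w x)%R.
have mh : measurable_fun setT h by exact: measurable_funD.
have mexp (v : X -> R) : measurable_fun setT v ->
    measurable_fun setT (fun x => (expR (v x))%:E).
  move=> mv; apply/measurable_EFinP.
  by apply: measurableT_comp; first exact: measurable_expR.
have mpa : measurable_fun setT (fun x => (psi x / a)%R) by exact: measurable_funM.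
have hexp : \int[mu]_x (expR (h x))%:E <= \int[mu]_x (expR (g x))%:E +
    (expR k)%:E * \int[mu]_(x in A) (expR (psi x / a))%:E.
  rewrite [X in _ + _ * X]integral_mkcond.
  have mr : measurable_fun setT ((fun x => (expR (psi x / a))%:E) \_ A).
    apply/(measurable_restrictT _ mA); apply: measurable_funTS; exact: mexp.
  have r0 x : 0 <= ((fun x => (expR (psi x / a))%:E) \_ A) x.
    by rewrite patchE; case: ifP.
  rewrite -ge0_integralZl// -ge0_integralD//; last 3 first.
  - exact: mexp.
  - by move=> x _; rewrite mule_ge0.
  - exact: measurable_funeM.
  apply: ge0_le_integral => //.
  - exact: mexp.
  - by apply: emeasurable_funD; [exact: mexp|exact: measurable_funeM].
  move=> x _; rewrite patchE /h /w indicE; case: (x \in A) => /=.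
    rewrite mulr1 -EFinM -EFinD lee_fin expRD (@le_trans _ _ (expR k * expR (psi x / a))%R)//.
      by rewrite ler_pM2r ?expR_gt0// ler_expR (le_trans (ler_norm _)).
    by rewrite lerDr expR_ge0.
  by rewrite mulr0 addr0 mule0 adde0.
have gbound : \int[mu]_x (expR (g x))%:E <= (expR k)%:E.
  rewrite -[leRHS]mule1 -(@probability_setT _ _ _ mu) -integral_cst//.
  apply: ge0_le_integral => //; first exact: mexp.
  by move=> x _; rewrite lee_fin ler_expR (le_trans (ler_norm _)).
have [] := @entropy_young _ _ _ mu nu h k H mh.
- move=> x; rewrite /h (le_trans _ (_ : g x <= _)%R)//; last by rewrite lerDl.
  by have := gk x; rewrite ler_norml => /andP[].
- apply: (le_lt_trans hexp); apply: lte_add_pinfty.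
    exact: le_lt_trans gbound (ltry _).
  rewrite lte_mul_pinfty//; apply: le_lt_trans psioo.
  apply: ge0_subset_integral => //; exact: mexp.
move=> hi hle.
have gi : nu.-integrable setT (EFin \o g).
  apply: (@le_integrable _ _ _ _ _ measurableT _ (EFin \o cst k)) => //.
  - exact/measurable_EFinP.
  - by move=> x _; rewrite /= lee_fin (ger0_norm (k0 x)).
  - exact: finite_measure_integrable_cst.
have wi : nu.-integrable setT (EFin \o w).
  rewrite (_ : EFin \o w = (EFin \o h) \- (EFin \o g)).
    exact: integrableB.
  by apply/funext => x; rewrite /= -EFinB /h addrAC subrr add0r.
apply: le_trans (leeD2l _ hexp); apply: le_trans hle.
rewrite leeD2r// (_ : \int[nu]_x (h x)%:E =
  \int[nu]_x (g x)%:E + \int[nu]_x (w x)%:E); last by rewrite -integralD.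
rewrite leeD2l// integral_mkcond -ge0_integralZl//.
- apply: ge0_le_integral => //.
  + move=> x _; rewrite mule_ge0 ?lee_fin ?invr_ge0 ?(ltW a0)// patchE.
    by case: ifP => // _; rewrite lee_fin.
  + apply: measurable_funeM; apply/(measurable_restrictT _ mA); apply: measurable_funTS.
    exact/measurable_EFinP.
  + exact/measurable_EFinP.
  + move=> x _; rewrite patchE /w indicE; case: (x \in A) => /=.
      by rewrite mulr1 -EFinM mulrC.
    by rewrite mule0 mulr0.
- apply/(measurable_restrictT _ mA); apply: measurable_funTS.
  exact/measurable_EFinP.
- by move=> x _; rewrite patchE; case: ifP => // _; rewrite lee_fin.
- by rewrite lee_fin invr_ge0 ltW.
Qed.

End integral_tails.

(** * Bounded integrands under setwise convergence *)

Section setwise_convergence.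
Context {d} {X : measurableType d} {R : realType}.

(** The level sets of [h] at mesh [e] do not depend on [P]: finitely many values [P (E j)] control
    the integral for all [P] at once. *)
Lemma integral_step_approx (e : R) (J : nat) (h : X -> R) : 0 < e ->
  measurable_fun setT h -> (forall x, 0 <= h x < J%:R * e) ->
  exists2 E : nat -> set X, (forall j, measurable (E j)) &
    forall P : probability X R,
      ((\sum_(j < J) (j%:R * e) * fine (P (E j)))%:E <= \int[P]_x (h x)%:E <=
       (\sum_(j < J) (j%:R * e) * fine (P (E j)) + e)%:E)%E.
Proof.
move=> e0 mh hJ.
pose E (j : nat) := h @^-1` `[j%:R * e, j.+1%:R * e[.
have mE j : measurable (E j) by rewrite -[X in measurable X]setTI; exact: mh.
exists E => // P.
pose s x : R := \sum_(j < J) (j%:R * e) * \1_(E j) x.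
have sx x : s x <= h x <= s x + e.
  pose n := Num.Def.trunc (h x / e).
  have /andP[h0 hlt] := hJ x.
  have /andP[n1 n2] : n%:R <= h x / e < n.+1%:R.
    by apply: truncn_itv; rewrite divr_ge0// ltW.
  have n1' : n%:R * e <= h x by rewrite -ler_pdivlMr.
  have n2' : h x < n.+1%:R * e by rewrite -ltr_pdivrMr.
  have nJ : (n < J)%N.
    by rewrite -(ltr_nat R) (le_lt_trans n1)// ltr_pdivrMr.
  have -> : s x = n%:R * e.
    rewrite /s (bigD1 (Ordinal nJ))//= indicE mem_set ?mulr1; last first.
      by rewrite /E/= in_itv/= n1'.
    rewrite big1 ?addr0// => j jn; rewrite indicE memNset ?mulr0//.
    rewrite /E/= in_itv/= => /andP[j1 j2].
    have jn1 : (j < n.+1)%N by rewrite -(ltr_nat R) -(ltr_pM2r e0) (le_lt_trans j1).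
    have nj1 : (n < j.+1)%N by rewrite -(ltr_nat R) -(ltr_pM2r e0) (le_lt_trans n1').
    by move/eqP : jn; apply; apply/val_inj/eqP; rewrite /= eqn_leq -ltnS jn1 -ltnS.
  by rewrite n1'/=; move: n2'; rewrite -natr1 mulrDl mul1r => /ltW.
have ms : measurable_fun setT s.
  by apply: measurable_sum => j; apply: measurable_funM => //; exact: measurable_indic.
have s0 x : 0 <= s x.
  by apply: sumr_ge0 => j _; rewrite mulr_ge0// mulr_ge0// ltW.
have intE : (\int[P]_x (s x)%:E = (\sum_(j < J) (j%:R * e) * fine (P (E j)))%:E)%E.
  under eq_integral do rewrite /s -sumEFin.
  rewrite ge0_integral_sum//; last 2 first.
  - by move=> j; apply/measurable_EFinP; apply: measurable_funM => //; exact: measurable_indic.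
  - by move=> j x _; rewrite lee_fin mulr_ge0// mulr_ge0// ltW.
  rewrite -sumEFin; apply: eq_bigr => j _; under eq_integral do rewrite EFinM.
  rewrite ge0_integralZl//; last 2 first.
  - by apply/measurable_EFinP; exact: measurable_indic.
  - by rewrite lee_fin mulr_ge0// ltW.
  by rewrite integral_indic// setIT [RHS]EFinM fineK// fin_num_measure.
rewrite EFinD -intE; apply/andP; split.
  apply: ge0_le_integral => //; [|exact/measurable_EFinP|exact/measurable_EFinP|].
  - by move=> x _; rewrite lee_fin.
  - by move=> x _; rewrite lee_fin; case/andP: (sx x).
rewrite -[X in (_ <= _ + X)%E]mule1 -(@probability_setT _ _ _ P) -integral_cst//.
rewrite -ge0_integralD//; last 3 first.
- by move=> x _; rewrite lee_fin.
- exact/measurable_EFinP.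
- by move=> x _; rewrite lee_fin ltW.
apply: ge0_le_integral => //.
- by move=> x _; rewrite lee_fin; case/andP: (hJ x).
- exact/measurable_EFinP.
- by apply: emeasurable_funD => //; exact/measurable_EFinP.
- by move=> x _; rewrite lee_fin; case/andP: (sx x).
Qed.

Lemma setwise_cvg_integral_le (I : Type) (U : set_system I) (FU : Filter U)
    (nu_ : I -> probability X R) (nu : probability X R) (g : X -> R) (B t : R) :
  (forall A, measurable A -> fine (nu_ i A) @[i --> U] --> fine (nu A)) ->
  measurable_fun setT g -> (forall x, `|g x| <= B) -> 0 < t ->
  \forall i \near U, (\int[nu]_x (g x)%:E <= \int[nu_ i]_x (g x)%:E + t%:E)%E.
Proof.
move=> cv mg gB t0.
have B0 : 0 <= B by exact: le_trans (normr_ge0 _) (gB point).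
pose h x := g x + B.
have mh : measurable_fun setT h by exact: measurable_funD.
pose e := t / 2.
have e0 : 0 < e by rewrite divr_gt0.
pose J := (Num.Def.trunc (2 * B / e)).+1.
have hJ x : 0 <= h x < J%:R * e.
  have := gB x; rewrite ler_norml => /andP[g1 g2].
  rewrite /h -lerBlDr sub0r g1/= -ltr_pdivrMr//.
  apply: (@le_lt_trans _ _ (2 * B / e)); last exact: truncnS_gt.
  by rewrite ler_pM2r ?invr_gt0//; lra.
have [E mE hE] := integral_step_approx e0 mh hJ.
(* Each of the [J] levels has weight at most [J%:R * e], so an error [r] on each set adds up to
   [e]. *)
pose r := e / (J%:R * (J%:R * e)).
have J0 : (0 : R) < J%:R by rewrite ltr0n.
have r0 : 0 < r by rewrite divr_gt0// mulr_gt0// mulr_gt0.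
have near1 : \forall i \near U, forall j : 'I_J, fine (nu (E j)) - r <= fine (nu_ i (E j)).
  apply: filter_forall => j; apply: (cvgr_ge _ (cv _ (mE j))).
  by rewrite gtrBl.
apply: filterS near1 => i hi.
have gint (P : probability X R) : P.-integrable setT (EFin \o g).
  apply: (@le_integrable _ _ _ _ _ measurableT _ (EFin \o cst B)) => //.
  - exact/measurable_EFinP.
  - by move=> x _; rewrite /= lee_fin (ger0_norm B0).
  - exact: finite_measure_integrable_cst.
have hg (P : probability X R) : (\int[P]_x (h x)%:E = \int[P]_x (g x)%:E + B%:E)%E.
  have ci : P.-integrable setT (EFin \o cst B) by exact: finite_measure_integrable_cst.
  have := integralD measurableT (gint P) ci.
  rewrite [X in (_ = _ + X)%E -> _](integral_cst P measurableT B%:E)/=.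
  by rewrite probability_setT mule1 => <-.
have /andP[_ u1] := hE nu.
have /andP[u2 _] := hE (nu_ i).
have sle : \sum_(j < J) j%:R * e * fine (nu (E j)) + e <=
    \sum_(j < J) j%:R * e * fine (nu_ i (E j)) + t.
  have -> : t = e + e by rewrite /e -splitr.
  rewrite addrA lerD2r -lerBlDl -sumrB.
  apply: (@le_trans _ _ (\sum_(j < J) J%:R * e * r)).
    apply: ler_sum => j _; rewrite -mulrBr (@le_trans _ _ (j%:R * e * r))//.
      apply: ler_wpM2l; first by rewrite mulr_ge0// ltW.
      by rewrite lerBlDr -lerBlDl; exact: hi.
    by rewrite ler_pM2r// ler_pM2r// ler_nat ltnW.
  rewrite sumr_const card_ord -mulr_natl le_eqVlt; apply/predU1P; left.
  by rewrite /r; field; rewrite !gt_eqF.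
have : (\int[nu]_x (h x)%:E <= \int[nu_ i]_x (h x)%:E + t%:E)%E.
  apply: (le_trans u1); apply: (le_trans _ (leeD2r _ u2)).
  by rewrite -EFinD lee_fin.
by rewrite !hg addeAC leeD2rE.
Qed.

End setwise_convergence.

(** * Coercivity, lower semicontinuity and existence *)

Section minimizer.
Context {d} {X : measurableType d} {R : realType}.
Variables (mu : probability X R) (c : X -> X -> R) (psi : X -> R) (C a b : R).
Hypothesis c_ge0 : forall x y, 0 <= c x y.
Hypothesis mc : measurable_fun setT (fun z => c z.1 z.2).
Hypothesis psi_ge0 : forall x, 0 <= psi x.
Hypothesis mpsi : measurable_fun setT psi.
Hypothesis C_ge0 : 0 <= C.
Hypothesis c_psi : forall x y, c x y <= psi x + C * psi y.
Hypothesis b_gt0 : 0 < b.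
Hypothesis ba : b < a.
Hypothesis exp_psi : (\int[mu]_x (expR (psi x / b))%:E < +oo)%E.
Hypothesis cells : forall L D : R, 1 < L -> 0 < D -> exists B : nat -> set X,
  [/\ forall i, measurable (B i), trivIset setT B, \bigcup_i B i = setT,
      forall i x x' y, B i x -> B i x' -> c x y <= L * c x' y + D &
      forall i, exists M, forall x, B i x -> psi x <= M].

Local Notation H nu := (relative_entropy mu nu).
Local Notation T nu := (transport_cost c nu mu).

Let a_gt0 : 0 < a. Proof. exact: lt_trans ba. Qed.
Let K := fine (\int[mu]_x (expR (psi x / b))%:E).

Let mpsiE : measurable_fun setT (fun x => (psi x)%:E).
Proof. exact/measurable_EFinP. Qed.
Let psiE_ge0 x : (0 <= (psi x)%:E)%E. Proof. by rewrite lee_fin. Qed.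

Let mexp k : measurable_fun setT (fun x => (expR (psi x / k))%:E).
Proof.
apply/measurable_EFinP; apply: measurableT_comp; first exact: measurable_expR.
exact: measurable_funM.
Qed.

Let KE : (\int[mu]_x (expR (psi x / b))%:E = K%:E)%E.
Proof. by rewrite fineK// ge0_fin_numE// integral_ge0. Qed.

Let exp_psi_a : (\int[mu]_x (expR (psi x / a))%:E < +oo)%E.
Proof.
apply: le_lt_trans exp_psi; apply: ge0_le_integral => //.
move=> x _; rewrite lee_fin ler_expR ler_wpM2l// lef_pV2 ?posrE//.
exact: ltW.
Qed.

Let psi_moment nu : (H nu < +oo)%E ->
  (\int[nu]_x (psi x)%:E <= b%:E * (H nu + K%:E))%E.
Proof.
move=> Hnu; have [] := @entropy_young _ _ _ mu nu (fun x => psi x / b) 0 Hnu.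
- exact: measurable_funM.
- by move=> x; rewrite oppr0 divr_ge0// ltW.
- exact: exp_psi.
move=> _ hle; rewrite KE in hle.
have -> : (\int[nu]_x (psi x)%:E = b%:E * \int[nu]_x (psi x / b)%:E)%E.
  rewrite -ge0_integralZl//.
  - apply: eq_integral => x _; rewrite -EFinM; congr (_%:E).
    by rewrite mulrC divfK// gt_eqF.
  - by apply/measurable_EFinP; exact: measurable_funM.
  - by move=> x _; rewrite lee_fin divr_ge0// ltW.
  - by rewrite lee_fin ltW.
rewrite lee_wpmul2l ?lee_fin ?(ltW b_gt0)// (le_trans _ hle)// leeDl//.
Qed.

Let P := fine (\int[mu]_x (psi x)%:E).
(** [mu] has finite entropy relative to itself, so [psi_moment] applies to it. *)
Let PE : (\int[mu]_x (psi x)%:E = P%:E)%E.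
Proof.
rewrite fineK// ge0_fin_numE ?integral_ge0//.
apply: (le_lt_trans (psi_moment (entropy_refl_lty mu))).
by rewrite -(fineK (entropy_fin_num (entropy_refl_lty mu))) -EFinD -EFinM ltry.
Qed.
Let P_ge0 : 0 <= P. Proof. by rewrite fine_ge0// integral_ge0. Qed.

Let C1 := b * K + C * P.

Let T_ge0 nu : (0 <= T nu)%E.
Proof.
by apply: le_ereal_inf_tmp => _ [pi _ <-]; apply: integral_ge0 => z _; rewrite lee_fin.
Qed.

Let H_real nu : (H nu < +oo)%E -> H nu = (fine (H nu))%:E.
Proof. by move=> Hnu; rewrite fineK// entropy_fin_num. Qed.

Let h_ge0 nu : 0 <= fine (H nu). Proof. by rewrite fine_ge0// entropy_ge0. Qed.

(** The product coupling and the moment bound give slope [b] in the entropy; [b < a] then yields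
    coercivity in [Fr_ge]. *)
Let T_le nu : (H nu < +oo)%E -> (T nu <= (b * fine (H nu) + C1)%:E)%E.
Proof.
move=> Hnu; apply: (le_trans (transport_le_product nu mu c_ge0 mc mpsi psi_ge0 C_ge0 c_psi)).
rewrite PE; apply: (le_trans (leeD2r _ (psi_moment Hnu))).
move: (H_real Hnu); set h := fine (H nu) => ->.
by rewrite -(EFinD h) -(EFinM b) -(EFinM C) -EFinD lee_fin /C1 mulrDr addrA.
Qed.

Let T_real nu : (H nu < +oo)%E -> T nu = (fine (T nu))%:E.
Proof.
by move=> Hnu; rewrite fineK// ge0_fin_numE// (le_lt_trans (T_le Hnu))// ltry.
Qed.

Let Fr nu := a * fine (H nu) - fine (T nu).

Let F_real nu : (H nu < +oo)%E -> F_functional c a mu nu = (Fr nu)%:E.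
Proof. by move=> Hnu; rewrite /F_functional (H_real Hnu) (T_real Hnu). Qed.

Let Fr_ge nu : (H nu < +oo)%E -> (a - b) * fine (H nu) - C1 <= Fr nu.
Proof.
move=> Hnu; have := T_le Hnu; rewrite (T_real Hnu) lee_fin /Fr; lra.
Qed.

Section lsc.
Variables (I : Type) (U : set_system I) (nu_ : I -> probability X R).
Variables (nu : probability X R) (S : R).
Context {UP : ProperFilter U}.
Hypothesis Hnu_ : forall i, (H (nu_ i) < +oo)%E.
Hypothesis Hnu : (H nu < +oo)%E.
Hypothesis cvnu : forall A, measurable A -> fine (nu_ i A) @[i --> U] --> fine (nu A).
Hypothesis minS : forall t, 0 < t -> \forall i \near U, Fr (nu_ i) <= S + t.

Let clip_choice t : 0 < t -> exists k f,
  [/\ is_density mu nu f, 0 <= k, expR (- k) <= t &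
      ((fine (H nu) - t)%:E <= \int[nu]_x (clip_ln (- k) k f x)%:E)%E].
Proof.
move=> t0; have [f [fD fi fE]] := finite_entropy_density Hnu.
have := clip_ln_cvg_entropy fD fi; rewrite -fE (H_real Hnu) => cv.
near \oo => k; exists (k%:R : R), f; split => //.
  have kt : t^-1 <= k%:R by near: k; exact: nbhs_infty_ger.
  rewrite expRN invf_ple ?posrE ?expR_gt0// (le_trans kt)//.
  by rewrite (le_trans _ (expR_ge1Dx _))// lerDr.
near: k.
have fin k : (\int[nu]_x (clip_ln (- k%:R) k%:R f x)%:E)%E \is a fin_num.
  have [mf _ _] := fD.
  apply: integrable_fin_num => //.
  apply: (@le_integrable _ _ _ _ _ measurableT _ (EFin \o cst k%:R)) => //.
  - by apply/measurable_EFinP; exact: clip_ln_measurable.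
  - move=> x _; rewrite /= lee_fin (ger0_norm (ler0n _ _)) ler_norml.
    by rewrite clip_ln_ge clip_ln_le// (@le_trans _ _ 0)// oppr_le0.
  - exact: finite_measure_integrable_cst.
have cvr : fine (\int[nu]_x (clip_ln (- k%:R) k%:R f x)%:E)%E @[k --> \oo] --> fine (H nu).
  by apply: fine_cvg; rewrite -(H_real Hnu) (H_real Hnu).
have := cvgr_ge _ cvr; move=> /(_ _ (fine (H nu) - t)); rewrite gtrBl => /(_ t0).
by apply: filterS => k hk; rewrite -(fineK (fin k)) lee_fin.
Unshelve. all: by end_near. Qed.

(** The order of choices matters: the clipping level [k], the coupling, the cells, the number [N] of
    cells (depending on [k]), the bound [M], the fraction [e] (depending on [M]), and last the index
    [i]. Transport loses [7 * t] and near-minimality [t]; entropy loses [4 * t], multiplied by [a].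
    The integral [W] of [psi] over the rest appears on both sides and cancels. *)
Let F_lsc_approx t : 0 < t -> Fr nu <= S + (8 + 4 * a) * t.
Proof.
move=> t0.
have [k [f [fD k0 kt hk]]] := clip_choice t0.
have [mf f0 _] := fD.
pose g := clip_ln (- k) k f.
have mg : measurable_fun setT g by exact: clip_ln_measurable.
have gk x : `|g x| <= k.
  by rewrite ler_norml clip_ln_ge clip_ln_le// (@le_trans _ _ 0)// oppr_le0.
have gfin (Q : probability X R) : (\int[Q]_x (g x)%:E)%E \is a fin_num.
  apply: integrable_fin_num => //.
  apply: (@le_integrable _ _ _ _ _ measurableT _ (EFin \o cst k)) => //.
  - exact/measurable_EFinP.
  - by move=> x _; rewrite /= lee_fin (ger0_norm k0).
  - exact: finite_measure_integrable_cst.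
have [pi [cpi hpi]] : exists pi, coupling nu mu pi /\
    (\int[pi]_z (c z.1 z.2)%:E <= (fine (T nu) + t)%:E)%E.
  have Tfin : T nu \is a fin_num by rewrite (T_real Hnu).
  have [_ [pi cpi <-] hlt] := lb_ereal_inf_adherent t0 Tfin.
  by exists pi; split => //; rewrite EFinD -(T_real Hnu); exact: ltW.
pose I0 := fine (\int[pi]_z (c z.1 z.2)%:E)%E.
have c_int : (\int[pi]_z (c z.1 z.2)%:E < +oo)%E by rewrite (le_lt_trans hpi)// ltry.
have cint_ge0 : (0 <= \int[pi]_z (c z.1 z.2)%:E)%E.
  by apply: integral_ge0 => z _; rewrite lee_fin.
have I0E : (\int[pi]_z (c z.1 z.2)%:E = I0%:E)%E by rewrite fineK// ge0_fin_numE.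
have I0_ge0 : 0 <= I0 by rewrite fine_ge0.
have I0le : I0 <= fine (T nu) + t by move: hpi; rewrite I0E lee_fin.
(* The multiplicative error is fitted to the cost of [pi], so that [L * I0 <= I0 + t]. *)
pose L := 1 + t / (I0 + 1).
have I01 : 0 < I0 + 1 by rewrite ltr_wpDl.
have L1 : 1 < L by rewrite ltrDl divr_gt0.
have LI : L * I0 <= I0 + t.
  rewrite mulrDl mul1r lerD2l mulrAC ler_pdivrMr// ler_pM2l//.
  by rewrite lerDl.
have [B [mB tB UB cB psiB]] := cells L1 t0.
have [Mi hMi] := choice psiB.
pose F n := \big[setU/set0]_(i < n) B i.
have FE n : F n = \bigcup_(i < n) B i by rewrite bigcup_mkord.
have mF n : measurable (F n) by apply: bigsetU_measurable.
have ndF : {homo F : i j / (i <= j)%N >-> i `<=` j}.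
  by move=> i j ij; rewrite !FE => x [l /= li Bx]; exists l => //=; exact: leq_trans ij.
have UF : \bigcup_i F i = setT.
  apply/seteqP; split => // x _; have : setT x by [].
  by rewrite -UB => -[i _ Bx]; exists i.+1 => //; rewrite FE; exists i => /=.
have exp_ge0 x : (0 <= (expR (psi x / a))%:E)%E by rewrite lee_fin expR_ge0.
(* The tolerance [t / expR k] anticipates the factor [expR k] in [entropy_young_restricted]. *)
have near1 := integral_exhaust_tail ndF mF UF (mexp a) exp_ge0 exp_psi_a
  (divr_gt0 t0 (expR_gt0 k)).
have C1_gt0 : 0 < C + 1 by rewrite ltr_wpDl.
have psi2_int : (\int[pi]_z (psi z.2)%:E < +oo)%E.
  by rewrite (coupling_integral_snd cpi mpsiE psiE_ge0) PE ltry.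
have mpsi2 : measurable_fun setT (fun z : X * X => (psi z.2)%:E).
  by apply/measurable_EFinP; exact: measurableT_comp.
have near2 : \forall n \near \oo,
    (\int[pi]_(z in ~` (F n `*` setT)) (psi z.2)%:E <= (t / (C + 1))%:E)%E.
  apply: integral_exhaust_tail => //.
  - by move=> i j ij [x y] [/= Fx _]; split => //; exact: ndF ij _ Fx.
  - by move=> i; exact: measurableX.
  - apply/seteqP; split => // -[x y] _.
    by have [i _ Fx] : (\bigcup_i F i) x; [rewrite UF|exists i].
  - exact: divr_gt0.
have [N [tail1 tail2]] := filter_ex (filterI near1 near2).
pose A i := if (i < N)%N then B i else if i == N then ~` F N else set0.
have AN : A N = ~` F N by rewrite /A ltnn eqxx.
have AB i : (i < N)%N -> A i = B i by rewrite /A => ->.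
have mA i : measurable (A i).
  rewrite /A; case: ifP => // _; case: ifP => // _; exact: measurableC.
have tA : trivIset setT A.
  apply/trivIsetP.
  have disj i j : (i < j)%N -> A i `&` A j = set0.
    move=> ij; rewrite /A; case: (ltnP i N) => iN; last first.
      by rewrite (gtn_eqF (leq_ltn_trans iN ij)) (ltnNge j) (ltnW (leq_ltn_trans iN ij))/= setI0.
    case: (ltnP j N) => jN; first by move/trivIsetP : tB; apply => //; rewrite ltn_eqF.
    case: eqP => _; last by rewrite setI0.
    by rewrite -subset0 => x [Bx []]; rewrite FE; exists i.
  by move=> i j _ _; rewrite neq_ltn => /orP[/disj//|/disj]; rewrite setIC.
have cA : \big[setU/set0]_(i < N.+1) A i = setT.
  apply/seteqP; split => // x _; rewrite -bigcup_mkord.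
  have [|nFx] := pselect (F N x).
    by rewrite FE => -[i /= iN Bx]; exists i; [exact: ltnW|rewrite AB].
  by exists N => //=; rewrite AN.
pose M := \sum_(i < N) `|Mi i|.
have M_ge0 : 0 <= M by exact: sumr_ge0.
have psiM i x : (i < N)%N -> A i x -> psi x <= M.
  move=> iN; rewrite AB// => /hMi /le_trans; apply.
  rewrite (le_trans (ler_norm _))// /M (bigD1 (Ordinal iN))//= lerDl.
  exact: sumr_ge0.
(* The three bounds give [e < 1], [M * e <= t] and [C * (e * P) <= t]; the added 1's keep the
   denominators positive. *)
pose e := Num.min 2^-1 (Num.min (t / (M + 1)) (t / ((C + 1) * (P + 1)))).
have M1 : 0 < M + 1 by rewrite ltr_wpDl.
have P1 : 0 < P + 1 by rewrite ltr_wpDl.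
have e_gt0 : 0 < e by rewrite !lt_min invr_gt0 ltr0n/= !divr_gt0// mulr_gt0.
have e_lt1 : e < 1.
  by rewrite (@le_lt_trans _ _ 2^-1) ?ge_min ?lexx// invf_lt1// ltr1n.
have eM : M * e <= t.
  rewrite (@le_trans _ _ ((M + 1) * e))//; first by rewrite ler_pM2r// lerDl.
  by rewrite mulrC -ler_pdivlMr// !ge_min lexx orbT.
have eP : C * (e * P) <= t.
  rewrite (@le_trans _ _ (e * ((C + 1) * (P + 1))))//.
    rewrite mulrCA ler_pM2l// ler_pM// lerDl//.
  by rewrite -ler_pdivlMr ?mulr_gt0// !ge_min lexx !orbT.
have near3 : \forall i \near U, forall j : 'I_N, (1 - e) * fine (nu (A j)) <= fine (nu_ i (A j)).
  (* A cell that is null for [nu] leaves no margin for the limit, but there the inequality is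
     trivial; otherwise [1 - e] provides the margin. *)
  apply: filter_forall => j; have := fine_ge0 (measure_ge0 nu (A j)).
  rewrite le_eqVlt => /predU1P[<-|mj].
    by apply: nearW => i; rewrite mulr0 fine_ge0.
  apply: (cvgr_ge _ (cvnu (mA j))); rewrite mulrBl mul1r gtrBl.
  exact: mulr_gt0.
have near4 : \forall i \near U, fine (nu (A N)) - e <= fine (nu_ i (A N)).
  by apply: (cvgr_ge _ (cvnu (mA N))); rewrite gtrBl.
have near5 : \forall i \near U, (\int[nu]_x (g x)%:E <= \int[nu_ i]_x (g x)%:E + t%:E)%E.
  exact: setwise_cvg_integral_le cvnu mg gk t0.
have [i [[n3 n4] [n5 n6]]] := filter_ex (filterI (filterI near3 near4) (filterI near5 (minS t0))).
have finA (Q : probability X R) j : (fine (Q (A j)))%:E = Q (A j).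
  by rewrite fineK// fin_num_measure.
have nu'_ge j : (j < N)%N -> ((1 - e)%:E * nu (A j) <= nu_ i (A j))%E.
  move=> jN; rewrite -(finA nu) -(finA (nu_ i)) -EFinM lee_fin.
  exact: (n3 (Ordinal jN)).
have e01 : 0 < e < 1 by rewrite e_gt0.
have cA_cell j x x' y : (j < N)%N -> A j x -> A j x' -> c x y <= L * c x' y + t.
  by move=> jN; rewrite AB//; exact: cB.
have psi_int : (\int[mu]_y (psi y)%:E < +oo)%E by rewrite PE ltry.
have := @transport_refine _ _ _ nu (nu_ i) mu pi N A e cpi mA tA cA e01 nu'_ge c psi C L t M
  c_ge0 mc psi_ge0 mpsi C_ge0 (ltW (lt_trans ltr01 L1)) (ltW t0) M_ge0 cA_cell
  c_psi psiM c_int psi_int.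
have Hi := Hnu_ i.
have psi_nui : (\int[nu_ i]_x (psi x)%:E < +oo)%E.
  by rewrite (le_lt_trans (psi_moment Hi))// (H_real Hi) -EFinD -EFinM ltry.
pose W := fine (\int[nu_ i]_(x in A N) (psi x)%:E)%E.
have WE : (\int[nu_ i]_(x in A N) (psi x)%:E = W%:E)%E.
  rewrite fineK// ge0_fin_numE ?integral_ge0//; apply: le_lt_trans psi_nui.
  exact: ge0_subset_integral.
have ANT : A N `*` [set: X] = ~` (F N `*` setT).
  by rewrite AN; apply/seteqP; split => -[x y] /=; tauto.
rewrite I0E WE PE -(finA nu) -(finA (nu_ i)) (T_real Hi) => hT.
have {}hT : fine (T (nu_ i)) <= fine (T nu) + 7 * t + W.
  rewrite -lee_fin; apply: (le_trans hT).
  have q2 : (C%:E * (e%:E * P%:E + \int[pi]_(z in A N `*` setT) (psi z.2)%:E) <= (t + t)%:E)%E.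
    rewrite ANT; apply: (le_trans (lee_wpmul2l _ (leeD2l _ tail2))); first by rewrite lee_fin.
    rewrite -(EFinM e) -EFinD -(EFinM C) lee_fin mulrDr lerD//.
    by rewrite mulrA ler_pdivrMr// mulrC ler_pM2l// lerDl.
  rewrite (le_trans (leeD2l _ q2))//.
  rewrite -(EFinM L) -(EFinD e) -EFinB -(EFinM M) -!EFinD lee_fin.
  have : M * (e + fine (nu (A N)) - fine (nu_ i (A N))) <= M * (e + e).
    by rewrite ler_wpM2l// -addrA lerD2l lerBlDr -lerBlDl.
  by move: LI eM I0le; lra.
have hY := entropy_young_restricted Hi mg gk mpsi psi_ge0 (mA N) a_gt0 exp_psi_a.
have {}hY : fine (\int[nu_ i]_x (g x)%:E)%E + W / a <= fine (H (nu_ i)) + 2 * t.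
  move: hY; rewrite WE (H_real Hi) -(fineK (gfin (nu_ i))) => hY.
  have q3 : ((expR k)%:E * \int[mu]_(x in A N) (expR (psi x / a))%:E <= t%:E)%E.
    rewrite AN; apply: (le_trans (lee_wpmul2l _ tail1)); first by rewrite lee_fin expR_ge0.
    by rewrite -EFinM lee_fin mulrC divfK// gt_eqF// expR_gt0.
  have q4 : (\int[mu]_x (expR (g x))%:E <= (1 + t)%:E)%E.
    by rewrite (le_trans (integral_exp_clip_ln _ _ fD))// -EFinD lee_fin lerD2l.
  have := le_trans hY (leeD2l _ (leeD q4 q3)).
  by rewrite -(EFinM a^-1) -!EFinD lee_fin [W / a]mulrC; lra.
have hG : fine (H nu) - 2 * t <= fine (\int[nu_ i]_x (g x)%:E)%E.
  have := le_trans hk n5; rewrite -(fineK (gfin (nu_ i))) -EFinD lee_fin; lra.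
have hW : a * (fine (\int[nu_ i]_x (g x)%:E)%E + W / a) =
    a * fine (\int[nu_ i]_x (g x)%:E)%E + W.
  by rewrite mulrDr mulrCA mulfV ?mulr1// gt_eqF.
have hY2 : a * (fine (\int[nu_ i]_x (g x)%:E)%E + W / a) <= a * (fine (H (nu_ i)) + 2 * t).
  by rewrite ler_pM2l.
have hG2 : a * (fine (H nu) - 2 * t) <= a * fine (\int[nu_ i]_x (g x)%:E)%E.
  by rewrite ler_pM2l.
by move: n6 hT hY2 hG2; rewrite hW /Fr; lra.
Qed.

Lemma F_lsc : Fr nu <= S.
Proof.
apply/ler_addgt0Pr => e e0.
have q0 : 0 < 8 + 4 * a by rewrite addr_gt0// mulr_gt0.
have t0 : 0 < e / (8 + 4 * a) by rewrite divr_gt0.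
by apply: (le_trans (F_lsc_approx t0)); rewrite lerD2l mulrC divfK// gt_eqF.
Qed.

End lsc.

Lemma minimizer_exists : exists nu : probability X R, (H nu < +oo)%E /\
  forall nu' : probability X R, (H nu' < +oo)%E ->
    (F_functional c a mu nu <= F_functional c a mu nu')%E.
Proof.
have ab0 : 0 < a - b by rewrite subr_gt0.
pose E := [set Fr nu | nu in [set nu : probability X R | (H nu < +oo)%E]].
have Einf : has_inf E.
  split; first by exists (Fr mu), mu => //=; exact: entropy_refl_lty.
  exists (- C1) => _ [nu /= Hnu <-]; apply: le_trans (Fr_ge Hnu).
  by rewrite lerDr mulr_ge0// ltW.
pose S := inf E.
have hn (n : nat) : exists nu : probability X R, (H nu < +oo)%E /\ Fr nu <= S + n.+1%:R^-1.
  have n0 : (0 : R) < n.+1%:R^-1 by rewrite invr_gt0.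
  have [_ [nu /= Hnu <-] hlt] := inf_adherent n0 Einf.
  by exists nu; split => //; exact: ltW.
have [nu_ hnu_] := choice hn.
(* Obtained by solving [(a - b) * fine (H nu) - C1 <= S + 1] for the entropy. *)
pose M := (S + 1 + C1) / (a - b).
have hM n : (H (nu_ n) <= M%:E)%E.
  have [Hn Fn] := hnu_ n; rewrite (H_real Hn) lee_fin ler_pdivlMr// mulrC.
  have n1 : n.+1%:R^-1 <= 1 :> R by rewrite invf_le1// ler1n.
  move: (n.+1%:R^-1) n1 Fn (Fr_ge Hn) => q; lra.
have [U [UU sU]] := ultraFilterLemma (eventually_filter).
have [nu [numu cvnu]] := entropy_bounded_setwise_limit UU hM.
have Hnu : (H nu < +oo)%E.
  have [f fD fE] := dominated_entropy_density numu; have [mf f0 _] := fD.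
  (* The bound is uniform in [k]: Young's inequality for [nu_ i] has exponential term at most 2, and
     its 1 offsets the error 1 of passing from [nu] to [nu_ i]. *)
  apply: (entropy_lty_of_clip (M := M + 2) fD fE) => k.
  have gB x : `|clip_ln 0 k%:R f x| <= k%:R.
    by rewrite ger0_norm ?clip_ln_ge// clip_ln_le.
  have mg := @clip_ln_measurable _ X R 0 k%:R f mf.
  have near1 : \forall i \near U, (\int[nu]_x (clip_ln 0 k%:R f x)%:E <=
      \int[nu_ i]_x (clip_ln 0 k%:R f x)%:E + 1%:E)%E.
    exact: setwise_cvg_integral_le cvnu mg gB ltr01.
  have [i hi] := filter_ex near1.
  apply: (le_trans hi).
  have := @entropy_young _ _ _ mu (nu_ i) (clip_ln 0 k%:R f) 0 (hnu_ i).1 mg.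
  have ex := integral_exp_clip_ln 0 k%:R fD.
  case.
  - by move=> x; rewrite oppr0 clip_ln_ge.
  - by rewrite (le_lt_trans ex)// expR0 -EFinD ltry.
  move=> _ /le_trans; apply.
  apply: (le_trans (leeD (hM i) ex)).
  by rewrite expR0 -!EFinD.
exists nu; split => // nu' Hnu'.
rewrite (F_real Hnu) (F_real Hnu') lee_fin.
apply: (@le_trans _ _ S); last by apply: inf_lbound; [exact: Einf.2|exists nu'].
apply: (@F_lsc nat U nu_ nu S) => // [n|t t0]; first exact: (hnu_ n).1.
apply: sU; near=> n.
apply: (le_trans (hnu_ n).2); rewrite lerD2l ltW//.
by near: n; exact: near_infty_natSinv_lt (PosNum t0).
Unshelve. all: by end_near. Qed.

End minimizer.

(** * Cells on which the cost varies little *)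

Section cost_cells.
Context {d} {X : measurableType d} {R : realType} (dist : X -> X -> R) (phi : R -> R).
Hypothesis Xpolish : polish dist.
Hypothesis Xborel : borel_for dist.
Hypothesis phiP : power_type phi.

Let dist_ge0 x y : 0 <= dist x y. Proof. by case: Xpolish => -[+ _ _ _] _ _; exact. Qed.
Let dist_sym x y : dist x y = dist y x. Proof. by case: Xpolish => -[_ _ + _] _ _; exact. Qed.
Let dist_tri x y z : dist x z <= dist x y + dist y z.
Proof. by case: Xpolish => -[_ _ _ +] _ _; exact. Qed.
Let phi_ge0 x : 0 <= x -> 0 <= phi x. Proof. by case: phiP => + _ _ _ _; exact. Qed.

(** The weak triangle inequality with [eta = L - 1] compares the costs from two points at distance
    at most [s], with error [C * phi s]. By convexity [phi s <= s * phi 1], so a small [s] brings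
    this below [D]. *)
Lemma cost_cells (x0 : X) (L D : R) : 1 < L -> 0 < D -> exists B : nat -> set X,
  [/\ forall i, measurable (B i), trivIset setT B, \bigcup_i B i = setT,
      forall i x x' y, B i x -> B i x' ->
        phi (dist x y) <= L * phi (dist x' y) + D &
      forall i, exists M, forall x, B i x -> phi (dist x x0) <= M].
Proof.
move=> L1 D0; have L10 : 0 < L - 1 by rewrite subr_gt0.
have [C C0 tri] := power_type_weak_triangle phiP L10.
have phi1 : 0 <= phi 1 by exact: phi_ge0.
have q0 : 0 < C * phi 1 + 1 by rewrite ltr_wpDl// mulr_ge0.
pose s := Num.min 1 (D / (C * phi 1 + 1)).
have s0 : 0 < s by rewrite lt_min ltr01 divr_gt0.
have s1 : s <= 1 by rewrite ge_min lexx.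
have Cs : C * phi s <= D.
  have := power_type_scale_le phiP ler01 (_ : 0 <= s <= 1); rewrite (ltW s0) s1.
  move=> /(_ erefl); rewrite mulr1 => h.
  apply: (le_trans (ler_wpM2l C0 h)); rewrite mulrCA.
  apply: (@le_trans _ _ (s * (C * phi 1 + 1))); first by rewrite ler_pM2l// lerDl.
  by rewrite -ler_pdivlMr// ge_min lexx orbT.
have s20 : 0 < s / 2 by rewrite divr_gt0.
have [q [B [mB tB UB Bq]]] := measurable_cells Xpolish Xborel s20.
exists B; split => //.
- move=> i x x' y /Bq xi /Bq x'i.
  have xx' : dist x' x <= s.
    rewrite (le_trans (dist_tri _ (q i) _))// (dist_sym x') [leRHS]splitr.
    by rewrite lerD// ltW.
  apply: (@le_trans _ _ (phi (dist x' y + dist x' x))).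
    by apply: (power_type_nondecreasing phiP) => //; rewrite addrC (dist_sym x').
  apply: (le_trans (tri _ _ (dist_ge0 _ _) (dist_ge0 _ _))).
  rewrite (addrC 1) subrK lerD2l (le_trans _ Cs)// ler_wpM2l//.
  exact: (power_type_nondecreasing phiP).
- move=> i; exists (phi (s / 2 + dist (q i) x0)) => x /Bq xi.
  apply: (power_type_nondecreasing phiP) => //.
  by rewrite (le_trans (dist_tri _ (q i) _))// lerD2r dist_sym ltW.
Qed.

End cost_cells.

Unset Implicit Arguments.

Theorem theorem2p9 (R : realType) (d : measure_display) (X : measurableType d)
  (dist : X -> X -> R) (mu : probability X R) (phi : R -> R) (a' r_o : R) :
  polish dist -> borel_for dist -> power_type phi ->
  0 < a' -> 0 <= r_o ->
  (forall A : set X, measurable A -> ((2^-1)%:E <= mu A)%E ->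
     forall r : R, r_o <= r ->
     forall B : set X, measurable B -> enlargement (dtilde dist phi) A r `<=` B ->
       ((1 - expR (- ((r - r_o) `^ cost_exponent phi) / a'))%:E <= mu B)%E) ->
  forall a : R, a' < a ->
  exists nu : probability X R,
    (relative_entropy mu nu < +oo)%E /\
    forall nu' : probability X R, (relative_entropy mu nu' < +oo)%E ->
      (F_functional (fun x y => phi (dist x y)) a mu nu
        <= F_functional (fun x y => phi (dist x y)) a mu nu')%E.
Proof.
move=> Xpolish Xborel phiP a'0 ro0 conc a aa.
have [[dist_ge0 _ dist_sym dist_tri] _ _] := Xpolish.
have phi_ge0 x : 0 <= x -> 0 <= phi x by case: phiP => + _ _ _ _; exact.
pose x0 : X := point.
(* The midpoint leaves room on both sides: below for exponential integrability with a factor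
   [1 + eta], above for coercivity. *)
pose b := (a' + a) / 2.
have a'b : a' < b by rewrite midf_lt.
have ba : b < a by rewrite midf_lt.
have [eta eta0 expi] :=
  concentration_exp_integrable Xpolish Xborel phiP a'0 ro0 conc x0 a'b.
have [C C0 tri] := power_type_weak_triangle phiP eta0.
have eta1 : 1 <= 1 + eta by rewrite lerDl ltW.
pose psi x := (1 + eta) * phi (dist x x0).
have mc := measurable_cost Xpolish Xborel phiP.
have mpsi : measurable_fun setT psi.
  apply: measurable_funM => //.
  exact: (measurableT_comp mc (pair2_measurable x0)).
have psi0 x : 0 <= psi x by rewrite mulr_ge0 ?phi_ge0// (le_trans _ eta1).
have c_psi x y : phi (dist x y) <= psi x + C * psi y.
  apply: (@le_trans _ _ (phi (dist x x0 + dist y x0))).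
    by apply: (power_type_nondecreasing phiP) => //; rewrite (dist_sym y).
  apply: (le_trans (tri _ _ (dist_ge0 _ _) (dist_ge0 _ _))).
  by rewrite lerD2l ler_wpM2l// ler_peMl// phi_ge0.
apply: (@minimizer_exists _ _ _ mu (fun x y => phi (dist x y)) psi C a b) => //.
- by move=> x y; exact: phi_ge0.
- exact: lt_trans a'b.
- apply: le_lt_trans expi; rewrite le_eqVlt; apply/predU1P; left.
  by apply: eq_integral => x _; rewrite /psi mulrAC.
- move=> L D L1 D0.
  have [B [mB tB UB cB MB]] := cost_cells Xpolish Xborel phiP x0 L1 D0.
  exists B; split => // i; have [M hM] := MB i.
  exists ((1 + eta) * M) => x /hM h; rewrite ler_wpM2l// (le_trans _ eta1)//.
Qed.
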